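(* Let $\Lambda$ be a finite dimensional basic and split Hopf algebra over a field $k$ whose structure group $\mathcal S$ is abelian, of order $s$. Let $c\in\mathbf Z\mathcal S$ be the canonical element of $\Lambda$ and let $r$ be the number of irreducible complex characters of $\mathcal S$ which do not vanish at $c$. Then $\mathbf C\otimes_{\mathbf Z} K_0^p(\Lambda)$ is isomorphic to the algebra $$\mathbf C^{2r}\times \mathbf C[\epsilon]^{\,s-r},$$ where $\mathbf C[\epsilon]=\mathbf C[X]/(X^2)$ is the algebra of dual numbers.
   Context: Let $\Lambda$ be a finite dimensional Hopf algebra over a field $k$ with counit $\varepsilon$. Modules are finitely generated left $\Lambda$-modules; $M\otimes N$ means the tensor product over $k$ with $\Lambda$-action through the comultiplication. $\Lambda$ is split if the endomorphism ring of every simple module is isomorphic to $k$, and basic if every simple module has multiplicity one in the maximal semisimple quotient algebra of $\Lambda$; basic and split together mean that all simple modules are one-dimensional over $k$. In that case the set $\mathcal S$ of isomorphism classes of simple modules is a group under $\otimes$, with unit the trivial module $k_\varepsilon$ ($k$ with action through $\varepsilon$) and $S^{-1}=S^*$, where $S^*=\mathrm{Hom}_k(S,k)$ is made a left module by means of the antipode; $\mathcal S$ is called the structure group of $\Lambda$. $K_0(\Lambda)$ is the free abelian group on isomorphism classes $[X]$ of modules modulo the relations $[X_2]=[X_1]+[X_3]$ for every split exact sequence $0\to X_1\to X_2\to X_3\to 0$; it is a ring with product induced by $\otimes$ and unit $[k_\varepsilon]$. The projective class ring $K_0^p(\Lambda)$ is the subring of $K_0(\Lambda)$ generated by the classes of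 projective modules and semisimple modules. For a module $M$, $\overline M$ denotes the sum of the composition factors of $M$ counted with multiplicity, viewed as an element of the integral group ring $\mathbf Z\mathcal S$. $P_1$ denotes the projective cover of $k_\varepsilon$, and the canonical element is $c=\overline{P_1}\in\mathbf Z\mathcal S$. Characters of $\mathcal S$ are extended linearly to $\mathbf C\mathcal S\supset\mathbf Z\mathcal S$; equivalently, $r$ is the number of non-zero coordinates of $c$ under an algebra isomorphism $\mathbf C\mathcal S\cong\mathbf C^{s}$.
   Formalization: The formal theorem assumes in addition that Λ is not semisimple; for semisimple Λ (e.g. Λ = k) the projective class ring is ZS of rank s, while the stated algebra has dimension 2s, so the claim as printed fails exactly there. *)

(* Defs.v *)
From HB Require Import structures.
From mathcomp Require Import all_boot all_order all_algebra all_fingroup all_field.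
From mathcomp Require Import mxrepresentation.
From mathcomp Require Import generic_quotient ring_quotient qpoly.
From mathcomp Require Import boolp classical_sets cardinality reals.
From mathcomp.real_closed Require Import complex mxtens.
From mathcomp.multinomials Require Import freeg.

Set Implicit Arguments.
Unset Strict Implicit.
Unset Printing Implicit Defensive.

Import GRing.Theory Num.Theory.
Local Open Scope ring_scope.
Local Open Scope quotient_scope.

(* [U (x) V] is encoded by coordinates in the bases [vbasis {:U}] and
   [vbasis {:V}]; [tlift f] is the linear map on [U (x) V] induced by a
   bilinear [f], as [tlift_tens] shows. *)
Section Tensor.
Variable k : fieldType.

Definition tensor (U V : vectType k) := 'M[k]_(\dim {:U}, \dim {:V}).

Definition tens (U V : vectType k) (u : U) (v : V) : tensor U V :=
  \matrix_(i, j) (coord (vbasis {:U}) i u * coord (vbasis {:V}) j v).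

Definition tlift (U V : vectType k) (W : lmodType k) (f : U -> V -> W)
    (t : tensor U V) : W :=
  \sum_i \sum_j t i j *: f (vbasis {:U})`_i (vbasis {:V})`_j.

Lemma tlift_is_linear (U V : vectType k) (W : lmodType k) f : linear (@tlift U V W f).
Proof.
move=> c t t'; rewrite /tlift scaler_sumr -big_split /=; apply: eq_bigr => i _.
rewrite scaler_sumr -big_split /=; apply: eq_bigr => j _.
by rewrite !mxE scalerDl scalerA.
Qed.
HB.instance Definition _ U V W f := GRing.isLinear.Build k _ _ _ (@tlift U V W f)
  (@tlift_is_linear U V W f).

Lemma eq_tlift (U V : vectType k) (W : lmodType k) (f g : U -> V -> W) : f =2 g -> tlift f =1 tlift g.
Proof. by move=> fg t; apply: eq_bigr => i _; apply: eq_bigr => j _; rewrite fg. Qed.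

Lemma tlift_tens (U V : vectType k) (W : lmodType k) (f : U -> V -> W) u v :
  (forall u, linear (f u)) -> (forall v, linear (f^~ v)) ->
  tlift f (tens u v) = f u v.
Proof.
move=> fl fr; pose fL u := GRing.isLinear.Build k V W _ (f u) (fl u).
pose f1 u : {linear V -> W} := HB.pack (f u) (fL u).
pose fR v := GRing.isLinear.Build k U W _ (f^~ v) (fr v).
pose f2 v : {linear U -> W} := HB.pack (f^~ v) (fR v).
rewrite [in RHS](coord_vbasis (memvf u)) -[f _ v]/(f2 v _) linear_sum /=.
apply: eq_bigr => i _; rewrite -[f _ v]/(f2 v _) linearZ /=.
rewrite [in RHS](coord_vbasis (memvf v)) -[f _ (\sum__ _)]/(f1 _ _) linear_sum /=.
rewrite scaler_sumr; apply: eq_bigr => j _.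
by rewrite -[f _ (_ *: _)]/(f1 _ _) linearZ /= scalerA mxE.
Qed.

Lemma tens_linl (U V : vectType k) (v : V) : linear ((@tens U V)^~ v).
Proof.
by move=> c x y; apply/matrixP => i j; rewrite !mxE linearP /= mulrDl mulrA.
Qed.
Lemma tens_linr (U V : vectType k) (u : U) : linear (@tens U V u).
Proof.
by move=> c x y; apply/matrixP => i j; rewrite !mxE linearP /= mulrDr mulrCA.
Qed.

Lemma tlift_linf (U V : vectType k) (W W' : lmodType k) (f : U -> V -> W)
    (g : {linear W -> W'}) t :
  g (tlift f t) = tlift (fun u v => g (f u v)) t.
Proof.
rewrite linear_sum; apply: eq_bigr => i _; rewrite linear_sum.
by apply: eq_bigr => j _; rewrite linearZ.
Qed.

Lemma tlift_lin (U V : vectType k) (W W' : lmodType k) (f : W' -> U -> V -> W) t :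
  (forall u v, linear (fun w => f w u v)) -> linear (fun w => tlift (f w) t).
Proof.
move=> fl c x y; rewrite /tlift scaler_sumr -big_split /=.
apply: eq_bigr => i _; rewrite scaler_sumr -big_split /=.
apply: eq_bigr => j _.
by rewrite fl scalerDr !scalerA mulrC.
Qed.

(* the product of the algebra [A (x) A] *)
Definition tmul (A : falgType k) (t u : tensor A A) : tensor A A :=
  tlift (fun a b => tlift (fun c d => tens (a * c) (b * d)) u) t.

End Tensor.

Record hopf (k : fieldType) (A : falgType k) := Hopf {
  comul : {linear A -> tensor A A};
  counit : {lrmorphism A -> k^o};
  antipode : {linear A -> A};
  comul1 : comul 1 = tens 1 1;
  comulM : forall a b, comul (a * b) = tmul (comul a) (comul b);
  (* coassociativity, with [(A (x) A) (x) A] identified to [A (x) (A (x) A)] *)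
  comulA : forall a,
    tlift (fun x y => tlift (fun x1 x2 => tens x1 (tens x2 y)) (comul x)) (comul a)
    = tlift (fun x y => tens x (comul y)) (comul a);
  counitl : forall a, tlift (fun x y => counit x *: y) (comul a) = a;
  counitr : forall a, tlift (fun x y => counit y *: x) (comul a) = a;
  antipodel : forall a,
    tlift (fun x y => antipode x * y) (comul a) = counit a *: 1;
  antipoder : forall a,
    tlift (fun x y => x * antipode y) (comul a) = counit a *: 1 }.

(* A finitely generated left module over a finite dimensional algebra is given
   by the action of the algebra on the column vectors ['cV[k]_mdim]. *)
Record amod (k : fieldType) (A : falgType k) := AMod {
  mdim : nat;
  mact : {lrmorphism A -> 'M[k]_mdim} }.

HB.instance Definition _ k A := gen_eqMixin (@amod k A).
HB.instance Definition _ k A := gen_choiceMixin (@amod k A).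

Section Modules.
Variables (k : fieldType) (A : falgType k).
Implicit Types X Y Z P S : amod A.

Definition is_hom X Y (f : 'M[k]_(mdim Y, mdim X)) :=
  forall a, f *m mact X a = mact Y a *m f.
Arguments is_hom : clear implicits.

Definition mono m n (f : 'M[k]_(m, n)) := forall v : 'cV[k]_n, f *m v = 0 -> v = 0.
Definition epi m n (f : 'M[k]_(m, n)) :=
  forall w : 'cV[k]_m, exists v : 'cV[k]_n, f *m v = w.

Definition iso X Y :=
  exists f g, [/\ is_hom X Y f, is_hom Y X g, g *m f = 1%:M & f *m g = 1%:M].

Definition exact_seq X1 X2 X3 (f : 'M[k]_(mdim X2, mdim X1))
    (g : 'M[k]_(mdim X3, mdim X2)) :=
  [/\ is_hom X1 X2 f, is_hom X2 X3 g, mono f, epi g &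
      forall v : 'cV[k]_(mdim X2), g *m v = 0 <-> exists u, f *m u = v].

Definition short_exact X1 X2 X3 := exists f g, @exact_seq X1 X2 X3 f g.

Definition split_exact X1 X2 X3 :=
  exists f g, @exact_seq X1 X2 X3 f g /\
    exists s, is_hom X3 X2 s /\ g *m s = 1%:M.

Definition simple X :=
  mdim X <> 0%N /\
  forall U : {vspace 'cV[k]_(mdim X)},
    (forall a v, v \in U -> mact X a *m v \in U) -> U = 0%VS \/ U = fullv.

(* finite direct sums of simple modules *)
Inductive semisimple : amod A -> Prop :=
| semisimple0 X : mdim X = 0%N -> semisimple X
| semisimpleS S Y X :
    simple S -> semisimple Y -> split_exact S X Y -> semisimple X.

(* The lifting property is tested on finitely generated modules only, which is
   enough since [P] is finitely generated. *)
Definition projective P :=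
  forall Y Z (p : 'M_(mdim Z, mdim Y)) (f : 'M_(mdim Z, mdim P)),
    is_hom Y Z p -> epi p -> is_hom P Z f ->
    exists g, is_hom P Y g /\ p *m g = f.

Definition projective_cover P X :=
  projective P /\
  exists p, [/\ is_hom P X p, epi p &
    forall Y (f : 'M_(mdim P, mdim Y)), is_hom Y P f -> epi (p *m f) -> epi f].

Lemma iso_refl X : iso X X.
Proof.
by exists 1%:M, 1%:M; split=> [a|a||]; rewrite ?mulmx1 ?mul1mx.
Qed.
Lemma iso_sym X Y : iso X Y -> iso Y X.
Proof. by move=> [f [g [? ? ? ?]]]; exists g, f. Qed.
Lemma hom_comp X Y Z f g : is_hom X Y f -> is_hom Y Z g -> is_hom X Z (g *m f).
Proof. by move=> hf hg a; rewrite -mulmxA hf mulmxA hg mulmxA. Qed.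
Lemma iso_trans Y X Z : iso X Y -> iso Y Z -> iso X Z.
Proof.
move=> [f [g [hf hg gf fg]]] [f' [g' [hf' hg' gf' fg']]].
exists (f' *m f), (g *m g'); split; try exact: hom_comp; rewrite mulmxA.
  by rewrite -(mulmxA g) gf' mulmx1.
by rewrite -(mulmxA f') fg mulmx1.
Qed.

Lemma split_exactP X1 X2 X3 : split_exact X1 X2 X3 ->
  exists f g q s,
    [/\ is_hom X1 X2 f, is_hom X2 X3 g, is_hom X2 X1 q & is_hom X3 X2 s] /\
    [/\ q *m f = 1%:M, g *m s = 1%:M, g *m f = 0 & f *m q + s *m g = 1%:M].
Proof.
move=> [f [g [[hf hg mf eg fg] [s [hs gs]]]]].
have injf n (u v : 'M_(_, n)) : f *m u = f *m v -> u = v.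
  move=> /eqP; rewrite -subr_eq0 -mulmxBr => /eqP e; apply/eqP.
  rewrite -subr_eq0; apply/eqP/matrixP => i j.
  have: f *m col j (u - v) = 0 by rewrite colE mulmxA e mul0mx.
  by move/mf/matrixP/(_ i 0); rewrite !mxE.
have gf0 : g *m f = 0.
  apply/matrixP => i j.
  have /fg : exists u, f *m u = col j f by exists (delta_mx j 0); rewrite colE.
  by rewrite colE mulmxA -colE => /matrixP/(_ i 0); rewrite !mxE.
have /all_sig[q0 q0P] (j : 'I_(mdim X2)) : {u | f *m u = col j (1%:M - s *m g)}.
  apply: cid; apply/fg; rewrite colE mulmxA mulmxBr mulmxA gs mulmx1 mul1mx.
  by rewrite subrr mul0mx.
pose q := \matrix_(i, j) q0 j i 0.
have fq : f *m q = 1%:M - s *m g.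
  apply/matrixP => i j; have /matrixP/(_ i 0) := q0P j; rewrite !mxE => <-.
  by apply: eq_bigr => l _; rewrite !mxE.
exists f, g, q, s; split; split=> //.
- move=> a; apply: injf; rewrite !mulmxA fq hf -mulmxA fq.
  by rewrite mulmxBl mulmxBr mul1mx mulmx1 -mulmxA hg mulmxA hs mulmxA.
- by apply: injf; rewrite mulmxA fq mulmxBl -mulmxA gf0 mulmx0 subr0 mul1mx mulmx1.
- by rewrite fq subrK.
Qed.

Lemma split_exactI X1 X2 X3 f g q s :
  is_hom X1 X2 f -> is_hom X2 X3 g -> is_hom X3 X2 s ->
  q *m f = 1%:M -> g *m s = 1%:M -> g *m f = 0 -> f *m q + s *m g = 1%:M ->
  split_exact X1 X2 X3.
Proof.
move=> hf hg hs qf gs gf fq; exists f, g; split; last by exists s.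
split=> // [v fv|w|v].
- by rewrite -[v]mul1mx -qf -mulmxA fv mulmx0.
- by exists (s *m w); rewrite mulmxA gs mul1mx.
split=> [gv|[u <-]]; last by rewrite mulmxA gf mul0mx.
exists (q *m v); rewrite -[RHS]mul1mx -fq mulmxDl -[s *m g *m v]mulmxA gv.
by rewrite mulmx0 addr0 mulmxA.
Qed.

Lemma iso_split_exact X1 X2 X3 Y1 Y2 Y3 : iso X1 Y1 -> iso X2 Y2 -> iso X3 Y3 ->
  split_exact X1 X2 X3 -> split_exact Y1 Y2 Y3.
Proof.
move=> [a1 [b1 [ha1 hb1 ba1 ab1]]] [a2 [b2 [ha2 hb2 ba2 ab2]]].
move=> [a3 [b3 [ha3 hb3 ba3 ab3]]] /split_exactP.
move=> [f [g [q [s [[hf hg hq hs] [qf gs gf fq]]]]]].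
apply: (@split_exactI _ _ _ (a2 *m (f *m b1)) (a3 *m (g *m b2))
          (a1 *m (q *m b2)) (a2 *m (s *m b3)));
  try by do ?[apply: hom_comp] => //.
- by rewrite !mulmxA -!(mulmxA _ b2) ba2 mulmx1 -!(mulmxA _ q) qf mulmx1.
- by rewrite !mulmxA -!(mulmxA _ b2) ba2 mulmx1 -!(mulmxA _ g) gs mulmx1.
- by rewrite !mulmxA -!(mulmxA _ b2) ba2 mulmx1 -!(mulmxA _ g) gf mulmx0 mul0mx.
rewrite !mulmxA -!(mulmxA _ b1) ba1 mulmx1 -!(mulmxA _ b3) ba3 mulmx1.
rewrite -mulmxDl -!(mulmxA a2) -mulmxDr fq mulmx1 //.
Qed.

Definition isob X Y := `[< iso X Y >].
Lemma isob_equiv : equiv_class_of isob.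
Proof.
split=> [X|X Y|Y X Z]; first exact/asboolP/iso_refl.
  by apply/asboolP/asboolP; apply: iso_sym.
by move=> /asboolP XY /asboolP YZ; apply/asboolP/(iso_trans XY).
Qed.
Canonical isob_equivRel := EquivRelPack isob_equiv.
Canonical isob_encModRel := defaultEncModRel isob.

Definition iso_class := {eq_quot isob}.
HB.instance Definition _ : EqQuotient _ isob iso_class := EqQuotient.on iso_class.
HB.instance Definition _ := Choice.on iso_class.

Definition cls X : iso_class := \pi X.

Lemma clsP X Y : cls X = cls Y <-> iso X Y.
Proof. by split=> [/eqquotP/asboolP //|XY]; apply/eqquotP/asboolP. Qed.

Lemma reprP X : iso (repr (cls X)) X.
Proof. by apply/clsP; rewrite /cls reprK. Qed.

(* [l] lists the classes of the factors of a composition series of [X]. *)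
Inductive comp_factors : amod A -> seq iso_class -> Prop :=
| comp_factors0 X : mdim X = 0%N -> comp_factors X [::]
| comp_factorsS X' X S l :
    short_exact X' X S -> simple S -> comp_factors X' l ->
    comp_factors X (cls S :: l).

Definition multiplicity X S (n : nat) :=
  exists2 l, comp_factors X l & count_mem (cls S) l = n.

Definition regular_mx (a : A) : 'M[k]_(\dim {:A}) :=
  \matrix_(i, j) coord (vbasis {:A}) i (a * (vbasis {:A})`_j).

Lemma regular_linear : linear regular_mx.
Proof.
by move=> c a b; apply/matrixP => i j; rewrite !mxE mulrDl -scalerAl linearP.
Qed.
Lemma regular_monoid : monoid_morphism regular_mx.
Proof.
split=> [|a b]; apply/matrixP => i j; rewrite !mxE.
  by rewrite mul1r coord_free ?(basis_free (vbasisP _)) //= eq_sym.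
rewrite -mulrA {1}(coord_vbasis (memvf (b * (vbasis {:A})`_j))) mulr_sumr.
rewrite linear_sum; apply: eq_bigr => l _.
by rewrite -scalerAr linearZ !mxE mulrC.
Qed.
HB.instance Definition _ :=
  GRing.isLinear.Build k A 'M[k]_(\dim {:A}) _ regular_mx regular_linear.
HB.instance Definition _ :=
  GRing.isMonoidMorphism.Build A 'M[k]_(\dim {:A}) regular_mx regular_monoid.

Definition regular : amod A := AMod regular_mx.

Definition semisimple_algebra := semisimple regular.

(* [phi] is an isomorphism from [k] to the algebra of endomorphisms of [S]. *)
Definition split_algebra :=
  forall S, simple S ->
    exists phi : {lrmorphism k^o -> 'M[k]_(mdim S)},
      injective phi /\ forall f, is_hom S S f <-> exists c, f = phi c.

End Modules.

Arguments is_hom {k A} X Y f.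
Arguments semisimple_algebra {k} A.
Arguments split_algebra {k} A.

Definition restriction (k : fieldType) (A B : falgType k) (pi : {lrmorphism A -> B})
    (X : amod B) : amod A :=
  AMod (GRing.LRMorphism.clone k A 'M[k]_(mdim X) *:%R (mact X \o pi) _).

Definition semisimple_quotient (k : fieldType) (A B : falgType k)
    (pi : {lrmorphism A -> B}) :=
  (forall b, exists a, pi a = b) /\ semisimple_algebra B.

Definition max_semisimple_quotient (k : fieldType) (A B : falgType k)
    (pi : {lrmorphism A -> B}) :=
  semisimple_quotient pi /\
  forall (B' : falgType k) (pi' : {lrmorphism A -> B'}),
    semisimple_quotient pi' -> exists q : {lrmorphism B -> B'}, q \o pi =1 pi'.

Definition basic_algebra (k : fieldType) (A : falgType k) :=
  exists (B : falgType k) (pi : {lrmorphism A -> B}),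
    max_semisimple_quotient pi /\
    forall S : amod A, simple S -> multiplicity (restriction pi (regular B)) S 1.

(* The monoid ring [Z[X]]: the free abelian group on [X], with the product
   extending that of [X]. *)
Section MonoidRing.
Variable X : monoidType.

Definition monoid_ring := {freeg X / int}.
HB.instance Definition _ := GRing.Lmodule.on monoid_ring.

Definition fgen (x : X) : monoid_ring := Freeg [:: (1, x)].
Definition fext (M : lmodType int) (f : X -> M) : monoid_ring -> M := fglift f.

Lemma fext_gen (M : lmodType int) f x : @fext M f (fgen x) = f x.
Proof. by rewrite /fext /fgen liftU scale1r. Qed.

Lemma fext_linear (M : lmodType int) f : linear (@fext M f).
Proof.
have fD : zmod_morphism (@fext M f) by exact: lift_is_additive.
pose fA := GRing.isZmodMorphism.Build _ _ (@fext M f) fD.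
pose f' : {additive monoid_ring -> M} := HB.pack (@fext M f) fA.
by move=> c p q; rewrite -[fext f _]/(f' _) raddfD -[c]intz !scaler_int raddfMz.
Qed.
HB.instance Definition _ (M : lmodType int) f :=
  GRing.isLinear.Build int monoid_ring M _ (@fext M f) (@fext_linear M f).

Lemma fgen_ind (P : monoid_ring -> Prop) :
  P 0 -> (forall x, P (fgen x)) -> (forall p q, P p -> P q -> P (p - q)) ->
  forall p, P p.
Proof.
move=> P0 Pg PB p.
have PN q : P q -> P (- q) by move=> Pq; rewrite -sub0r; apply: PB.
have PD q r : P q -> P r -> P (q + r).
  by move=> Pq Pr; rewrite -[r]opprK; apply: PB => //; apply: PN.
have PMn q n : P q -> P (q *+ n).
  by move=> Pq; elim: n => [|n IH]; rewrite ?mulr0n // mulrS; apply: PD.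
rewrite -[p]freeg_sumE; elim/big_ind: _ => // x _.
have -> : Freeg [:: (coeff x p, x)] = fgen x *~ coeff x p.
  by rewrite /fgen freeg_mulz intz.
by case: (coeff x p) => n; [exact: PMn|apply: PN; exact: PMn].
Qed.

Definition fmul (p q : monoid_ring) : monoid_ring :=
  fext (fun x => fext (fun y => fgen (x * y)%g) q) p.

Fact fmulBl : forall r p q, fmul (p - q) r = fmul p r - fmul q r.
Proof. by move=> r p q; rewrite /fmul linearB. Qed.
Fact fmulBr : forall p q r, fmul p (q - r) = fmul p q - fmul p r.
Proof.
move=> p q r; elim/fgen_ind: p => [|x|p p' IH IH'].
- by rewrite /fmul !linear0 ?addr0.
- by rewrite /fmul !fext_gen linearB.
- by rewrite !fmulBl IH IH' !opprD !opprK addrACA.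
Qed.
Fact fmul0 p : fmul p 0 = 0. Proof. by have := fmulBr p 0 0; rewrite !subrr. Qed.
Fact f0mul p : fmul 0 p = 0. Proof. by rewrite /fmul linear0. Qed.
Fact fmul_gen x y : fmul (fgen x) (fgen y) = fgen (x * y)%g.
Proof. by rewrite /fmul !fext_gen. Qed.

Fact fmulA : associative fmul.
Proof.
move=> p q r; elim/fgen_ind: p => [|x|p p' IH IH']; rewrite ?f0mul //; last first.
  by rewrite !fmulBl IH IH'.
elim/fgen_ind: q => [|y|q q' IH IH']; rewrite ?(fmul0, f0mul) //; last first.
  by rewrite !(fmulBl, fmulBr) IH IH'.
elim/fgen_ind: r => [|z|r r' IH IH']; rewrite ?(fmul0, f0mul) //; last first.
  by rewrite !(fmulBl, fmulBr) IH IH'.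
by rewrite !fmul_gen mulgA.
Qed.
Fact fmul1l : left_id (fgen 1%g) fmul.
Proof.
elim/fgen_ind => [|x|p q IH IH']; rewrite ?fmul0 ?fmul_gen ?mul1g //.
by rewrite fmulBr IH IH'.
Qed.
Fact fmul1r : right_id (fgen 1%g) fmul.
Proof.
elim/fgen_ind => [|x|p q IH IH']; rewrite ?f0mul ?fmul_gen ?mulg1 //.
by rewrite fmulBl IH IH'.
Qed.
Fact fmulDl : left_distributive fmul +%R.
Proof. by move=> p q r; rewrite /fmul linearD. Qed.
Fact fmulDr : right_distributive fmul +%R.
Proof.
move=> p q r; rewrite -[r in LHS]opprK fmulBr -(sub0r r) fmulBr fmul0 sub0r.
by rewrite opprK.
Qed.
HB.instance Definition _ := GRing.Zmodule_isPzRing.Build monoid_ring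
  fmulA fmul1l fmul1r fmulDl fmulDr.

Lemma fgenM x y : fgen x * fgen y = fgen (x * y)%g.
Proof. exact: fmul_gen. Qed.
End MonoidRing.

(* For a set [rel] of elements of [Z[X]] stable under left and right products
   by elements of [X], the subgroup generated by [rel] is a two-sided ideal;
   [presented] is the quotient of [Z[X]] by that subgroup. *)
Record relations (X : monoidType) := Relations {
  rel_set :> monoid_ring X -> Prop;
  rel_mull : forall x p, rel_set p -> rel_set (fgen x * p);
  rel_mulr : forall x p, rel_set p -> rel_set (p * fgen x) }.

Section Presented.
Variables (X : monoidType) (rel : relations X).

Definition generated (p : monoid_ring X) : bool :=
  `[< forall G : {pred monoid_ring X}, zmod_closed G ->
        (forall q, rel q -> q \in G) -> p \in G >].

Fact generated_zmod : zmod_closed generated.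
Proof.
split=> [|p q /asboolP hp /asboolP hq]; apply/asboolP => G Gz GR.
  by case: Gz.
by case: (Gz) => _; apply; [exact: hp|exact: hq].
Qed.
HB.instance Definition _ :=
  GRing.isZmodClosed.Build (monoid_ring X) generated generated_zmod.

Lemma generated_mem p : rel p -> p \in generated.
Proof. by move=> relp; apply/asboolP => G _; apply. Qed.

Lemma generatedMl p q : q \in generated -> p * q \in generated.
Proof.
move=> qI; elim/fgen_ind: p => [|x|p p' IH IH'].
- by rewrite mul0r rpred0.
- move/asboolP: (qI) => /(_ (fun q => fgen x * q \in generated)); apply.
    split=> [|u v hu hv]; first by rewrite -topredE /= mulr0 rpred0.
    by rewrite -topredE /= mulrBr; apply: rpredB.
  by move=> r rr; apply: generated_mem; apply: rel_mull.
- by rewrite mulrBl rpredB.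
Qed.
Lemma generatedMr p q : q \in generated -> q * p \in generated.
Proof.
move=> qI; elim/fgen_ind: p => [|x|p p' IH IH'].
- by rewrite mulr0 rpred0.
- move/asboolP: (qI) => /(_ (fun q => q * fgen x \in generated)); apply.
    split=> [|u v hu hv]; first by rewrite -topredE /= mul0r rpred0.
    by rewrite -topredE /= mulrBl; apply: rpredB.
  by move=> r rr; apply: generated_mem; apply: rel_mulr.
- by rewrite mulrBr rpredB.
Qed.

Definition presented := Quotient.quot (GRing.ZmodClosed.clone _ generated _).
HB.instance Definition _ := ZmodQuotient.on presented.
Definition pproj (p : monoid_ring X) : presented := \pi p.

Lemma pprojP p q : pproj p = pproj q <-> p - q \in generated.
Proof.
rewrite /pproj; split=> [/eqP|h]; first by rewrite -Quotient.idealrBE.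
by apply/eqP; rewrite -Quotient.idealrBE.
Qed.

Lemma pprojB p q : pproj (p - q) = pproj p - pproj q.
Proof. exact: raddfB. Qed.
Lemma pprojD p q : pproj (p + q) = pproj p + pproj q.
Proof. exact: raddfD. Qed.

Lemma pproj_surj a : exists p, a = pproj p.
Proof. by exists (repr a); rewrite /pproj reprK. Qed.

Definition pmul (a b : presented) : presented := pproj (repr a * repr b).

Lemma pprojM p q : pmul (pproj p) (pproj q) = pproj (p * q).
Proof.
apply/pprojP; set p' := repr _; set q' := repr _.
have pI : p' - p \in generated by apply/pprojP; rewrite /pproj reprK.
have qI : q' - q \in generated by apply/pprojP; rewrite /pproj reprK.
have -> : p' * q' - p * q = p' * (q' - q) + (p' - p) * q.
  by rewrite mulrBr mulrBl addrA subrK.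
by apply: rpredD; [exact: generatedMl|exact: generatedMr].
Qed.

Fact pmulA : associative pmul.
Proof.
move=> a b c; have [p ->] := pproj_surj a; have [q ->] := pproj_surj b.
by have [r ->] := pproj_surj c; rewrite !pprojM mulrA.
Qed.
Fact pmul1l : left_id (pproj 1) pmul.
Proof. by move=> a; have [p ->] := pproj_surj a; rewrite pprojM mul1r. Qed.
Fact pmul1r : right_id (pproj 1) pmul.
Proof. by move=> a; have [p ->] := pproj_surj a; rewrite pprojM mulr1. Qed.
Fact pmulDl : left_distributive pmul +%R.
Proof.
move=> a b c; have [p ->] := pproj_surj a; have [q ->] := pproj_surj b.
by have [r ->] := pproj_surj c; rewrite -pprojD !pprojM mulrDl pprojD.
Qed.
Fact pmulDr : right_distributive pmul +%R.
Proof.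
move=> a b c; have [p ->] := pproj_surj a; have [q ->] := pproj_surj b.
by have [r ->] := pproj_surj c; rewrite -pprojD !pprojM mulrDr pprojD.
Qed.
HB.instance Definition _ := GRing.Zmodule_isPzRing.Build presented
  pmulA pmul1l pmul1r pmulDl pmulDr.

Definition pclass (x : X) : presented := pproj (fgen x).

Lemma pclassM x y : pclass x * pclass y = pclass (x * y)%g.
Proof. by rewrite /pclass -fgenM -pprojM. Qed.
Lemma pclass1 : pclass 1%g = 1. Proof. by []. Qed.

Lemma presented_ind (P : presented -> Prop) :
  P 0 -> (forall x, P (pclass x)) -> (forall a b, P a -> P b -> P (a - b)) ->
  forall a, P a.
Proof.
move=> P0 Pg PB a; have [p ->] := pproj_surj a; elim/fgen_ind: p => [||p q].
- by rewrite -(subrr 0) pprojB subrr.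
- exact: Pg.
- by rewrite pprojB; exact: PB.
Qed.
End Presented.
Arguments pclass {X} rel x.

(* [C (x)_Z T] for a commutative ring [C] and a ring [T]: generated by the
   pure tensors [(c, t)] subject to biadditivity. *)
Section BaseChange.
Variables (C : comNzRingType) (T : pzRingType).

Definition pure_tensor : Type := C * T.
HB.instance Definition _ := Choice.on pure_tensor.
Definition pt_mul (x y : pure_tensor) : pure_tensor := (x.1 * y.1, x.2 * y.2).
Fact pt_mulA : associative pt_mul.
Proof. by move=> x y z; rewrite /pt_mul !mulrA. Qed.
Fact pt_mul1l : left_id (1, 1) pt_mul.
Proof. by case=> c t; rewrite /pt_mul /= !mul1r. Qed.
Fact pt_mul1r : right_id (1, 1) pt_mul.
Proof. by case=> c t; rewrite /pt_mul /= !mulr1. Qed.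
HB.instance Definition _ := hasMul.Build pure_tensor pt_mul.
HB.instance Definition _ := Magma_isSemigroup.Build pure_tensor pt_mulA.
HB.instance Definition _ := hasOne.Build pure_tensor (1, 1).
HB.instance Definition _ := BaseUMagma_isUMagma.Build pure_tensor pt_mul1l pt_mul1r.

Definition pure (c : C) (t : T) : monoid_ring pure_tensor :=
  fgen ((c, t) : pure_tensor).

Inductive biadditive : monoid_ring pure_tensor -> Prop :=
| biadditivel c c' t : biadditive (pure (c + c') t - pure c t - pure c' t)
| biadditiver c t t' : biadditive (pure c (t + t') - pure c t - pure c t').

Fact biadditive_mull x p : biadditive p -> biadditive (fgen x * p).
Proof.
case: x => d u [c c' t|c t t']; rewrite !mulrBr !fgenM /=.
  by rewrite -[(_ * _)%g]/(d * (c + c'), u * t) mulrDr; apply: biadditivel.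
by rewrite -[(_ * _)%g]/(d * c, u * (t + t')) mulrDr; apply: biadditiver.
Qed.
Fact biadditive_mulr x p : biadditive p -> biadditive (p * fgen x).
Proof.
case: x => d u [c c' t|c t t']; rewrite !mulrBl !fgenM /=.
  by rewrite -[(_ * _)%g]/((c + c') * d, t * u) mulrDl; apply: biadditivel.
by rewrite -[(_ * _)%g]/(c * d, (t + t') * u) mulrDl; apply: biadditiver.
Qed.

Definition base_change := presented (Relations biadditive_mull biadditive_mulr).
HB.instance Definition _ := GRing.PzRing.on base_change.

Definition bc (c : C) (t : T) : base_change := pclass _ ((c, t) : pure_tensor).

Lemma bcM c t d u : bc c t * bc d u = bc (c * d) (t * u).
Proof. exact: pclassM. Qed.
Lemma bcDl c d t : bc (c + d) t = bc c t + bc d t.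
Proof.
rewrite -pprojD; apply/pprojP; rewrite opprD addrA.
by apply: generated_mem; apply: biadditivel.
Qed.
Lemma bcDr c t u : bc c (t + u) = bc c t + bc c u.
Proof.
rewrite -pprojD; apply/pprojP; rewrite opprD addrA.
by apply: generated_mem; apply: biadditiver.
Qed.

Definition bc_scale (c : C) (a : base_change) : base_change := bc c 1 * a.
Fact bc_scaleA c d a : bc_scale c (bc_scale d a) = bc_scale (c * d) a.
Proof. by rewrite /bc_scale mulrA bcM mulr1. Qed.
Fact bc_scale1 : left_id 1 bc_scale.
Proof. by move=> a; rewrite /bc_scale mul1r. Qed.
Fact bc_scaleDr : right_distributive bc_scale +%R.
Proof. by move=> c a b; rewrite /bc_scale mulrDr. Qed.
Fact bc_scaleDl a : {morph bc_scale^~ a : c d / c + d}.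
Proof. by move=> c d; rewrite /bc_scale bcDl mulrDl. Qed.
HB.instance Definition _ := GRing.Zmodule_isLmodule.Build C base_change
  bc_scaleA bc_scale1 bc_scaleDr bc_scaleDl.

Lemma bc_scaleE c d t : c *: bc d t = bc (c * d) t.
Proof. by rewrite -[LHS]/(bc c 1 * _) bcM mul1r. Qed.
Lemma bc_scaleAl c (a b : base_change) : c *: (a * b) = c *: a * b.
Proof. exact: mulrA. Qed.
Lemma bc_scaleAr c (a b : base_change) : c *: (a * b) = a * (c *: b).
Proof.
rewrite -![c *: _]/(bc c 1 * _) !mulrA; congr (_ * b).
elim/presented_ind: a => [|[d t]|a a' IH IH']; rewrite ?mulr0 ?mul0r //.
  by rewrite -[pclass _ _]/(bc d t) !bcM mulr1 mul1r mulrC.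
by rewrite mulrBr mulrBl IH IH'.
Qed.
End BaseChange.

Section HopfModules.
Variables (k : fieldType) (A : falgType k) (H : hopf A).
Implicit Types X Y Z : amod A.

Lemma tensmx_linl m n p q (N : 'M[k]_(p, q)) :
  linear (fun M : 'M[k]_(m, n) => M *t N).
Proof. by move=> c x y; apply/matrixP => i j; rewrite !mxE mulrDl mulrA. Qed.
Lemma tensmx_linr m n p q (M : 'M[k]_(m, n)) :
  linear (fun N : 'M[k]_(p, q) => M *t N).
Proof. by move=> c x y; apply/matrixP => i j; rewrite !mxE mulrDr mulrCA. Qed.

Lemma tens1mx m n : (1%:M : 'M[k]_m) *t (1%:M : 'M[k]_n) = 1%:M.
Proof.
apply/matrixP => i j; case: (mxtens_indexP i) => i0 i1.
case: (mxtens_indexP j) => j0 j1; rewrite tensmxE !mxE.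
by rewrite (can_eq (@mxtens_indexK m n)) xpair_eqE -natrM mulnb.
Qed.

Lemma castmx_linear m n (e : m = n) :
  linear (fun M : 'M[k]_m => castmx (e, e) M : 'M[k]_n).
Proof. by case: n / e => c x y; rewrite !castmx_id. Qed.

Definition tensor_act X Y (a : A) : 'M[k]_(mdim X * mdim Y) :=
  tlift (fun b c => mact X b *t mact Y c) (comul H a).

Lemma tensor_act_linear X Y : linear (tensor_act X Y).
Proof. by move=> c a b; rewrite /tensor_act !linearP. Qed.

Lemma act_linl X Y (M : 'M[k]_(mdim X)) b :
  linear (fun a => (M *m mact X a) *t mact Y b).
Proof. by move=> c x y; rewrite linearP /= mulmxDr -scalemxAr tensmx_linl. Qed.

Lemma tensor_act_monoid X Y : monoid_morphism (tensor_act X Y).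
Proof.
split=> [|a b].
  rewrite /tensor_act comul1 tlift_tens; first by rewrite !rmorph1 [LHS]tens1mx.
    by move=> a c x y; rewrite linearP /= tensmx_linr.
  by move=> b c x y; rewrite linearP /= tensmx_linl.
pose F c d := mact X c *t mact Y d.
rewrite /tensor_act comulM /tmul -[tlift (fun c d => _) _]/(tlift F _).
rewrite (tlift_linf _ (tlift F)).
pose G M : 'M[k]_(mdim X * mdim Y) := M *m tlift F (comul H b).
have Glin : linear G by move=> c x y; rewrite /G mulmxDl -scalemxAl.
pose GL : {linear _ -> _} := HB.pack G (GRing.isLinear.Build _ _ _ _ G Glin).
rewrite -[LHS]/(_) -[RHS]/(GL _) tlift_linf; apply: eq_tlift => c d /=.
rewrite (tlift_linf _ (tlift F)) /G.
pose K M : 'M[k]_(mdim X * mdim Y) := F c d *m M.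
have Klin : linear K by move=> e x y; rewrite /K mulmxDr -scalemxAr.
pose KL : {linear _ -> _} := HB.pack K (GRing.isLinear.Build _ _ _ _ K Klin).
rewrite -[RHS]/(KL _) tlift_linf; apply: eq_tlift => e f /=.
rewrite tlift_tens /F /K ?tensmx_mul ?rmorphM //.
  by move=> a' c' x y; rewrite linearP /= tensmx_linr.
by move=> b' c' x y; rewrite linearP /= tensmx_linl.
Qed.
HB.instance Definition _ X Y :=
  GRing.isLinear.Build k A 'M[k]_(mdim X * mdim Y) _ (tensor_act X Y)
    (@tensor_act_linear X Y).
HB.instance Definition _ X Y :=
  GRing.isMonoidMorphism.Build A 'M[k]_(mdim X * mdim Y) (tensor_act X Y)
    (@tensor_act_monoid X Y).

Definition tensor_mod X Y : amod A := AMod (tensor_act X Y).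

Definition trivial_act (a : A) : 'M[k]_1 := (counit H a)%:M.
Lemma trivial_act_linear : linear trivial_act.
Proof. by move=> c a b; rewrite /trivial_act linearP raddfD /= scale_scalar_mx. Qed.
Lemma trivial_act_monoid : monoid_morphism trivial_act.
Proof.
by split=> [|a b]; rewrite /trivial_act ?rmorph1 // rmorphM /= scalar_mxM.
Qed.
HB.instance Definition _ :=
  GRing.isLinear.Build k A 'M[k]_1 _ trivial_act trivial_act_linear.
HB.instance Definition _ :=
  GRing.isMonoidMorphism.Build A 'M[k]_1 trivial_act trivial_act_monoid.

Definition trivial_mod : amod A := AMod trivial_act.

Lemma iso_cast X Y (e : mdim X = mdim Y) :
  (forall a, castmx (e, e) (mact X a) = mact Y a) -> iso X Y.
Proof.
case: X Y e => [m x] [n y] /= e; case: n / e y => y xy.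
by exists 1%:M, 1%:M; split=> [a|a||]; rewrite ?mulmx1 ?mul1mx //= -xy castmx_id.
Qed.

Lemma tensor_hom X X' Y Y' f g : is_hom X X' f -> is_hom Y Y' g ->
  is_hom (tensor_mod X Y) (tensor_mod X' Y') (f *t g).
Proof.
move=> hf hg a /=.
rewrite /tensor_act /tlift mulmx_sumr mulmx_suml; apply: eq_bigr => i _.
rewrite mulmx_sumr mulmx_suml; apply: eq_bigr => j _.
by rewrite -scalemxAr -scalemxAl !tensmx_mul hf hg.
Qed.

Lemma tensor_iso X X' Y Y' : iso X X' -> iso Y Y' ->
  iso (tensor_mod X Y) (tensor_mod X' Y').
Proof.
move=> [f [g [hf hg gf fg]]] [f' [g' [hf' hg' gf' fg']]].
exists (f *t f'), (g *t g'); split; try exact: tensor_hom.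
  by rewrite tensmx_mul gf gf' tens1mx.
by rewrite tensmx_mul fg fg' tens1mx.
Qed.

Lemma tensmxA m n p (M : 'M[k]_m) (N : 'M[k]_n) (P : 'M[k]_p)
    (e : (m * (n * p))%N = (m * n * p)%N) :
  castmx (e, e) (M *t (N *t P)) = M *t N *t P.
Proof.
apply/matrixP => i j; rewrite castmxE !mxE mulrA.
have h (l : 'I_(m * n * p)) :
  [/\ (mxtens_unindex (cast_ord (esym e) l)).1 =
        (mxtens_unindex (mxtens_unindex l).1).1,
      (mxtens_unindex (mxtens_unindex (cast_ord (esym e) l)).2).1 =
        (mxtens_unindex (mxtens_unindex l).1).2 &
      (mxtens_unindex (mxtens_unindex (cast_ord (esym e) l)).2).2 =
        (mxtens_unindex l).2].
  split; apply/val_inj => /=; move: (nat_of_ord l) => t.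
  - by rewrite mulnC divnMA.
  - by rewrite modn_divl.
  - by rewrite modn_dvdm // dvdn_mull.
by have [-> -> ->] := h i; have [-> -> ->] := h j.
Qed.

Lemma tensor_modA X Y Z :
  iso (tensor_mod X (tensor_mod Y Z)) (tensor_mod (tensor_mod X Y) Z).
Proof.
have e : (mdim X * (mdim Y * mdim Z))%N = (mdim X * mdim Y * mdim Z)%N.
  exact: mulnA.
apply: (@iso_cast (tensor_mod X (tensor_mod Y Z)) (tensor_mod (tensor_mod X Y) Z) e) => a /=.
pose n := (mdim X * mdim Y * mdim Z)%N.
pose F x t : 'M[k]_n :=
  tlift (fun y z => mact X x *t mact Y y *t mact Z z) t.
have FS x y z : F x (tens y z) = mact X x *t mact Y y *t mact Z z.
  apply: (@tlift_tens k A A 'M[k]_n) => [u|v] c u' v'.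
    by rewrite linearP /= tensmx_linr.
  by rewrite linearP /= tensmx_linr tensmx_linl.
have Flin : (forall x, linear (F x)) * (forall t, linear (F^~ t)).
  split=> [x|t]; first by move=> c t u; rewrite /F linearP.
  apply: tlift_lin => u v c x y.
  by rewrite linearP /= !tensmx_linl.
have FL t u : tlift F (tens t u) = F t u by apply: tlift_tens; apply Flin.
transitivity (tlift F (tlift (fun x y => tens x (comul H y)) (comul H a))).
  rewrite (tlift_linf _ (tlift F)) /tensor_act.
  pose G := fun M : 'M[k]_(mdim X * (mdim Y * mdim Z)) => castmx (e, e) M.
  have Glin : linear G by exact: castmx_linear.
  pose GL : {linear _ -> _} := HB.pack G (GRing.isLinear.Build _ _ _ _ G Glin).
  rewrite -[LHS]/(GL _) tlift_linf; apply: eq_tlift => x y /=; rewrite FL /F.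
  pose K M : 'M[k]_(mdim X * mdim Y * mdim Z) := G (mact X x *t M).
  have Klin : linear K by move=> c u v; rewrite /K tensmx_linr Glin.
  pose KL : {linear _ -> _} := HB.pack K (GRing.isLinear.Build _ _ _ _ K Klin).
  rewrite -[LHS]/(KL _) tlift_linf; apply: eq_tlift => u v /=.
  exact: tensmxA.
rewrite -comulA (tlift_linf _ (tlift F)); apply: eq_tlift => x y.
rewrite (tlift_linf _ (tlift F)) /= /tensor_act.
pose K M : 'M[k]_n := M *t mact Z y.
have Klin : linear K by move=> c u v; rewrite /K tensmx_linl.
pose KL : {linear _ -> _} := HB.pack K (GRing.isLinear.Build _ _ _ _ K Klin).
rewrite -[RHS]/(KL _) tlift_linf; apply: eq_tlift => u v /=.
by rewrite FL FS.
Qed.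

Lemma tensor_mod1l X : iso (tensor_mod trivial_mod X) X.
Proof.
apply: (@iso_cast (tensor_mod trivial_mod X) X (mul1n _)) => a /=.
rewrite -[in RHS](counitl H a) (tlift_linf _ (mact X)) /tensor_act.
pose G := fun M : 'M[k]_(1 * mdim X) => castmx (mul1n (mdim X), mul1n (mdim X)) M.
have Glin : linear G by exact: castmx_linear.
pose GL : {linear _ -> _} := HB.pack G (GRing.isLinear.Build _ _ _ _ G Glin).
rewrite -[LHS]/(GL _) tlift_linf; apply: eq_tlift => x y /=.
rewrite linearZ /G /=; apply/matrixP => i j; rewrite castmxE !mxE /=.
rewrite !ord1 eqxx mulr1n; congr (_ * mact X y _ _).
  by apply/val_inj; rewrite /= modn_small.
by apply/val_inj; rewrite /= modn_small.
Qed.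

Lemma tensor_mod1r X : iso (tensor_mod X trivial_mod) X.
Proof.
apply: (@iso_cast (tensor_mod X trivial_mod) X (muln1 _)) => a /=.
rewrite -[in RHS](counitr H a) (tlift_linf _ (mact X)) /tensor_act.
pose G := fun M : 'M[k]_(mdim X * 1) => castmx (muln1 (mdim X), muln1 (mdim X)) M.
have Glin : linear G by exact: castmx_linear.
pose GL : {linear _ -> _} := HB.pack G (GRing.isLinear.Build _ _ _ _ G Glin).
rewrite -[LHS]/(GL _) tlift_linf; apply: eq_tlift => x y /=.
rewrite linearZ /G /=; apply/matrixP => i j; rewrite castmxE !mxE /=.
rewrite !ord1 eqxx mulr1n mulrC; congr (_ * mact X x _ _).
  by apply/val_inj; rewrite /= divn1.
by apply/val_inj; rewrite /= divn1.
Qed.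

Lemma tensor_split_exactl Y X1 X2 X3 : split_exact X1 X2 X3 ->
  split_exact (tensor_mod Y X1) (tensor_mod Y X2) (tensor_mod Y X3).
Proof.
move=> /split_exactP[f [g [q [s [[hf hg hq hs] [qf gs gf fq]]]]]].
have h1 : is_hom Y Y 1%:M by move=> a; rewrite mul1mx mulmx1.
apply: (@split_exactI _ _ (tensor_mod Y X1) (tensor_mod Y X2) (tensor_mod Y X3)
  (1%:M *t f) (1%:M *t g) (1%:M *t q) (1%:M *t s)); try exact: tensor_hom.
- by rewrite tensmx_mul qf mul1mx tens1mx.
- by rewrite tensmx_mul gs mul1mx tens1mx.
- by rewrite tensmx_mul gf tensmx0.
- rewrite !tensmx_mul mul1mx -tens1mx -fq.
  by have := tensmx_linr (1%:M : 'M_(mdim Y)) 1 (f *m q) (s *m g); rewrite !scale1r.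
Qed.

Lemma tensor_split_exactr Y X1 X2 X3 : split_exact X1 X2 X3 ->
  split_exact (tensor_mod X1 Y) (tensor_mod X2 Y) (tensor_mod X3 Y).
Proof.
move=> /split_exactP[f [g [q [s [[hf hg hq hs] [qf gs gf fq]]]]]].
have h1 : is_hom Y Y 1%:M by move=> a; rewrite mul1mx mulmx1.
apply: (@split_exactI _ _ (tensor_mod X1 Y) (tensor_mod X2 Y) (tensor_mod X3 Y)
  (f *t 1%:M) (g *t 1%:M) (q *t 1%:M) (s *t 1%:M)); try exact: tensor_hom.
- by rewrite tensmx_mul qf mul1mx tens1mx.
- by rewrite tensmx_mul gs mul1mx tens1mx.
- by rewrite tensmx_mul gf tens0mx.
- rewrite !tensmx_mul mul1mx -tens1mx -fq.
  by have := tensmx_linl (1%:M : 'M_(mdim Y)) 1 (f *m q) (s *m g); rewrite !scale1r.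
Qed.

(* the isomorphism classes of modules, as a monoid under the tensor product *)
Definition tensor_class (_ : hopf A) : Type := iso_class A.
Notation tclass := (tensor_class H).
HB.instance Definition _ := Choice.on tclass.
HB.instance Definition _ := EqQuotient.on tclass.

Definition tcls X : tclass := cls X.
Definition tmul_class (x y : tclass) : tclass := tcls (tensor_mod (repr x) (repr y)).

Lemma tmul_cls X Y : tmul_class (tcls X) (tcls Y) = tcls (tensor_mod X Y).
Proof. by apply/clsP/tensor_iso; apply: reprP. Qed.
Lemma tcls_surj (x : tclass) : exists X, x = tcls X.
Proof. by exists (repr x); rewrite /tcls /cls reprK. Qed.

Fact tmul_classA : associative tmul_class.
Proof.
move=> x y z; have [X ->] := tcls_surj x; have [Y ->] := tcls_surj y.
by have [Z ->] := tcls_surj z; rewrite !tmul_cls; apply/clsP/tensor_modA.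
Qed.
Fact tmul_class1l : left_id (tcls trivial_mod) tmul_class.
Proof. by move=> x; have [X ->] := tcls_surj x; rewrite tmul_cls; apply/clsP/tensor_mod1l. Qed.
Fact tmul_class1r : right_id (tcls trivial_mod) tmul_class.
Proof. by move=> x; have [X ->] := tcls_surj x; rewrite tmul_cls; apply/clsP/tensor_mod1r. Qed.
HB.instance Definition _ := hasMul.Build tclass tmul_class.
HB.instance Definition _ := Magma_isSemigroup.Build tclass tmul_classA.
HB.instance Definition _ := hasOne.Build tclass (tcls trivial_mod).
HB.instance Definition _ := BaseUMagma_isUMagma.Build tclass tmul_class1l tmul_class1r.

Lemma tclsM X Y : (tcls X * tcls Y)%g = tcls (tensor_mod X Y).
Proof. exact: tmul_cls. Qed.
Lemma tcls1 : tcls trivial_mod = 1%g. Proof. by []. Qed.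

Inductive split_relation : monoid_ring tclass -> Prop :=
| SplitRelation X1 X2 X3 : split_exact X1 X2 X3 ->
    split_relation (fgen (tcls X2) - (fgen (tcls X1) + fgen (tcls X3))).

Fact split_relation_mull x p : split_relation p -> split_relation (fgen x * p).
Proof.
have [X ->] := tcls_surj x => -[X1 X2 X3 sX].
rewrite mulrBr mulrDr !fgenM !tclsM; constructor.
exact: tensor_split_exactl.
Qed.
Fact split_relation_mulr x p : split_relation p -> split_relation (p * fgen x).
Proof.
have [X ->] := tcls_surj x => -[X1 X2 X3 sX].
rewrite mulrBl mulrDl !fgenM !tclsM; constructor.
exact: tensor_split_exactr.
Qed.

Definition K0 := presented (Relations split_relation_mull split_relation_mulr).
HB.instance Definition _ := GRing.PzRing.on K0.

Definition K0_class X : K0 := pclass _ (tcls X).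

Lemma K0_classM X Y : K0_class X * K0_class Y = K0_class (tensor_mod X Y).
Proof. by rewrite -[LHS]/(pclass _ _ * pclass _ _) pclassM tclsM. Qed.
Lemma K0_class1 : K0_class trivial_mod = 1. Proof. by []. Qed.
Lemma K0_class_split X1 X2 X3 : split_exact X1 X2 X3 ->
  K0_class X2 = K0_class X1 + K0_class X3.
Proof.
move=> sX; rewrite -[RHS]pprojD; apply/pprojP.
by apply: generated_mem; constructor.
Qed.

Definition in_K0p (x : K0) : bool :=
  `[< forall G : {pred K0}, subring_closed G ->
        (forall X, projective X \/ semisimple X -> K0_class X \in G) ->
        x \in G >].

Fact in_K0p_subring : subring_closed in_K0p.
Proof.
split=> [|x y /asboolP hx /asboolP hy|x y /asboolP hx /asboolP hy];
  apply/asboolP => G Gr GX; case: (Gr) => G1 GB GM //.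
  by apply: GB; [exact: hx|exact: hy].
by apply: GM; [exact: hx|exact: hy].
Qed.

Record K0p := MkK0p { K0p_val : K0; _ : in_K0p K0p_val }.
HB.instance Definition _ := [isSub for K0p_val].
HB.instance Definition _ := [Choice of K0p by <:].
HB.instance Definition _ := GRing.SubChoice_isSubPzRing.Build K0 in_K0p K0p
  in_K0p_subring.

(* the group of isomorphism classes of simple modules *)
Record structure_group := StructureGroup {
  sgroup :> finGroupType;
  sclass : sgroup -> tclass;
  sclass_inj : injective sclass;
  sclass_simple : forall X, simple X <-> exists g, sclass g = tcls X;
  sclass1 : sclass 1%g = 1%g;
  sclassM : {morph sclass : g h / (g * h)%g} }.

(* [c], as a function on [S], is the element of [Z[S]] written with an overline *)
Definition composition_sum (S : structure_group) M (c : {ffun S -> int}) :=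
  exists2 l, comp_factors M l & forall g, c g = (count_mem (sclass g) l)%:Z.

Definition canonical_element (S : structure_group) (c : {ffun S -> int}) :=
  exists2 P1, projective_cover P1 trivial_mod & composition_sum P1 c.

End HopfModules.

Section Characters.
Variables (C : fieldType) (G : finGroupType).

Definition irreducible_character (chi : {ffun G -> C}) :=
  exists n (rG : mx_representation C [set: G] n),
    mx_irreducible rG /\ forall g, chi g = \tr (rG g).

Definition char_eval (chi : {ffun G -> C}) (c : {ffun G -> int}) : C :=
  \sum_g (c g)%:~R * chi g.
End Characters.

(* Main.v *)
Require Import Defs.
From HB Require Import structures.
From mathcomp Require Import all_boot all_order all_algebra all_fingroup all_field.
From mathcomp Require Import generic_quotient cyclic mxrepresentation qpoly.
From mathcomp Require Import boolp classical_sets cardinality reals.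
From mathcomp Require Import ring.
From mathcomp.real_closed Require Import complex mxtens.

Set Implicit Arguments.
Unset Strict Implicit.
Unset Printing Implicit Defensive.

Import GRing.Theory Num.Theory.
Local Open Scope ring_scope.

(** Let S be the structure group and let p be the class of the projective cover P_1
    of the trivial module.  The theorem holds because K_0^p is the quadratic
    extension ZS[x] / (x^2 - c x), with p in the place of x ([K0p_presentation]),
    and because extending scalars to C splits ZS into a product over characters.
    The factor of the character chi is C[x] / (x^2 - chi(c) x), which is C x C when
    chi(c) is nonzero and the algebra of dual numbers otherwise
    ([base_change_split]).

    Each simple module g is invertible for the tensor product, so it is a line
    ([simple_dim1]).  Tensoring with g on either side is restriction along an
    automorphism of the algebra, the convolution of the identity with the character
    of g ([tensor_smodl], [tensor_smodr]).  It therefore preserves projective covers: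
    both g (x) P_1 and P_1 (x) g are projective covers of g.  Hence p commutes with S
    ([class_P1_comm]), and since a projective module splits off the cover of any of
    its simple quotients, its class lies in ZS p ([class_projective]).  Tensoring a
    composition series of P_1 with P_1 gives a filtration whose factors g (x) P_1 are
    projective, so that it splits and p^2 = c p ([comp_factors_tensor_P1]).  Thus
    K_0^p = ZS + ZS p.

    The elements g and g p are linearly independent by means of two invariants
    attached to each g: the dimension of Hom(X, g), and that of the subspace of maps
    that factor through the cover of g ([class_functionals]).  Both are additive in
    X.  Both are 1 on the cover of g and 0 on the other covers.  On simple modules
    the first is again a Kronecker delta, while the second vanishes because the
    cover of g is not a line, the algebra not being semisimple ([P1_dim_gt1]). *)

(* Unqualified, [mact] would denote the action attached to a permutation morphism. *)
Local Notation mact := Defs.mact.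

(** * Characters of a finite abelian group *)

Section CharacterTable.
Variables (C : numClosedFieldType) (G : finGroupType).
Hypothesis G_abelian : abelian [set: G].

Definition is_linear_character (chi : {ffun G -> C}) :=
  chi 1%g = 1 /\ forall g h, chi (g * h)%g = chi g * chi h.

Lemma irreducible_characterP (chi : {ffun G -> C}) :
  irreducible_character chi <-> is_linear_character chi.
Proof.
split=> [[n [rG [irr chiE]]]|[chi1 chiM]].
  have n1 : n = 1%N.
    by apply: mx_irr_abelian_linear irr G_abelian; apply: group_closure_closed_field.
  subst n; split=> [|g h]; rewrite !chiE; first by rewrite repr_mx1 mxtrace1.
  rewrite repr_mxM ?inE //; rewrite [rG g]mx11_scalar [rG h]mx11_scalar.
  by rewrite -scalar_mxM !mxtrace_scalar.
have chi_repr : mx_repr [set: G] (fun g => (chi g)%:M : 'M_1).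
  by split=> [|g h _ _]; rewrite ?chi1 // chiM scalar_mxM.
exists 1%N, (MxRepresentation chi_repr); split=> [|g]; last by rewrite /= mxtrace_scalar.
exact/mx_abs_irrW/linear_mx_abs_irr.
Qed.

Let n := #|[set: G]|.-1.
Let cardG : #|G| = n.+1.
Proof. by rewrite /n prednK ?cardsT // -cardsT cardG_gt0. Qed.
Let o (g : G) : 'I_n.+1 := cast_ord cardG (enum_rank g).
Let e (i : 'I_n.+1) : G := enum_val (cast_ord (esym cardG) i).
Let oK : cancel o e. Proof. by move=> g; rewrite /o /e cast_ordK enum_rankK. Qed.
Let eK : cancel e o. Proof. by move=> g; rewrite /o /e enum_valK cast_ordKV. Qed.

(** On row vectors, read as functions on [G], this matrix translates the argument by
    [g]. *)
Definition regrep (g : G) : 'M[C]_n.+1 := \matrix_(i, j) (e i == (g * e j)%g)%:R.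

Let regrepE (v : 'rV_n.+1) g h : (v *m regrep g) 0 (o h) = v 0 (o (g * h)%g).
Proof.
rewrite mxE (bigD1 (o (g * h)%g)) //= mxE !oK eqxx mulr1 big1 ?addr0 // => i ni.
by rewrite mxE oK -(can_eq eK) oK in ni *; rewrite (negPf ni) mulr0.
Qed.
Let mx_ext (M N : 'M[C]_n.+1) :
  (forall v : 'rV_n.+1, forall h, (v *m M) 0 (o h) = (v *m N) 0 (o h)) -> M = N.
Proof.
move=> MN; apply/row_matrixP => i; rewrite !rowE; apply/rowP => j.
by rewrite -[j]eK MN.
Qed.

Lemma regrepM g h : regrep (g * h)%g = regrep g *m regrep h.
Proof. by apply: mx_ext => v x; rewrite mulmxA !regrepE mulgA. Qed.

Lemma regrep1 : regrep 1%g = 1%:M.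
Proof. by apply: mx_ext => v x; rewrite regrepE mul1g mulmx1. Qed.

Lemma regrepX g m : regrep (g ^+ m)%g = regrep g ^+ m.
Proof.
elim: m => [|m IH]; first by rewrite expg0 expr0 regrep1.
by rewrite expgS exprS regrepM IH.
Qed.

Lemma regrep_diag g : diagonalizable (regrep g).
Proof.
apply/diagonalizableP.
have n0 : (n.+1%:R : C) != 0 by rewrite pnatr_eq0.
have := separable_Xn_sub_1 n0.
have [rs] := closed_field_poly_normal ('X^(n.+1) - 1 : {poly C}).
rewrite lead_coefXnsubC // scale1r => E; rewrite E separable_prod_XsubC => rsu.
exists rs => //; rewrite -E; apply: mxminpoly_min.
rewrite rmorphB rmorph1 /= rmorphXn /= horner_mx_X.
rewrite -regrepX.
have -> : (g ^+ n.+1 = 1)%g by rewrite -cardG -cardsT expg_cardG ?inE.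
by rewrite regrep1 subrr.
Qed.

(** The regular representation is a commuting family of diagonalizable matrices.
    A common eigenvector [v] satisfies v(g) = d(g) v(1), so up to scaling of its
    rows the matrix that diagonalizes the family is the character table, which is
    therefore invertible.  There is no further character: [chi] is itself an
    eigenvector, with eigenvalue [chi], and so has the same eigenvalue as any basis
    vector that occurs in its expansion. *)
Lemma linear_characters_basis : exists X : G -> {ffun G -> C},
  [/\ injective X, forall chi, is_linear_character chi <-> exists i, chi = X i,
      forall f : G -> C, exists a : G -> C, forall i, \sum_g a g * X i g = f i &
      forall a : G -> C, (forall i, \sum_g a g * X i g = 0) -> forall g, a g = 0].
Proof.
have [P Pu /allP/= Pd] : codiagonalizable [seq regrep g | g : G].
  apply/codiagonalizableP; split=> [_ _ /mapP[g _ ->] /mapP[h _ ->]|_ /mapP[g _ ->]].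
    rewrite /comm_mx -!regrepM; congr regrep.
    by apply: (centsP G_abelian); rewrite inE.
  exact: regrep_diag.
have eig i g h : P i (o (g * h)%g) = (P *m regrep g *m invmx P) i i * P i (o h).
  have gin : regrep g \in [seq regrep g | g : G] by apply: map_f; rewrite mem_enum.
  have /(diagonalizable_forP _ Pu) dg := Pd _ gin.
  have := regrepE (row i P) g h; rewrite -row_mul ![row _ _ _ _]mxE => <-.
  rewrite -[in LHS](mulmxKV Pu (P *m regrep g)) [LHS]mxE (bigD1 i) //= big1 ?addr0 //.
  move=> j ji.
  by rewrite dg ?mul0r // eq_sym.
pose z i := P i (o 1%g); pose d i g := P i (o g) / z i.
have Pz i g : P i (o g) = (P *m regrep g *m invmx P) i i * z i by rewrite -eig mulg1.
have z0 i : z i != 0.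
  apply/eqP => zi; have : row i P = 0.
    by apply/rowP => j; rewrite -[j]eK !mxE Pz zi mulr0.
  move/(congr1 (mulmx^~ (invmx P))); rewrite -row_mul mulmxV // mul0mx.
  by move/rowP/(_ i); rewrite !mxE eqxx => /eqP; rewrite oner_eq0.
have dE i g : (P *m regrep g *m invmx P) i i = d i g by rewrite /d Pz mulfK.
have PE i g : P i (o g) = z i * d i g by rewrite Pz dE mulrC.
have sum_o (F : 'I_n.+1 -> C) : \sum_j F j = \sum_g F (o g).
  by apply: reindex; exists e => ? _; rewrite ?oK ?eK.
pose X i := [ffun g => d (o i) g]; have XE i g : X i g = d (o i) g by rewrite ffunE.
have Xlin i : is_linear_character (X i).
  split=> [|g h]; first by rewrite XE /d -/(z _) divff.
  by rewrite !XE -[d _ g]dE /d eig mulrA.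
have Xsolve f : exists a : G -> C, forall i, \sum_g a g * X i g = f i.
  pose a := invmx P *m \col_i (z i * f (e i)).
  exists (fun g => a (o g) 0) => i.
  have /matrixP/(_ (o i) 0) : P *m a = \col_i (z i * f (e i)) by rewrite mulKVmx.
  rewrite !mxE sum_o oK => /(congr1 ( *%R (z (o i))^-1)); rewrite mulKf // => <-.
  by rewrite mulr_sumr; apply: eq_bigr => g _; rewrite XE PE -mulrA mulKf // mulrC.
exists X; split=> [i j Xij|chi||a a0 g] //.
- apply/eqP/negPn/negP => nij; have [a aE] := Xsolve (fun h => (h == i)%:R).
  have := aE i; rewrite Xij aE eqxx eq_sym (negPf nij) => /esym/eqP.
  by rewrite oner_eq0.
- split=> [[chi1 chiM]|[i ->] //].
  (* [b] is [chi] written in the eigenbasis; any nonzero entry of it selects the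
     row that [chi] equals. *)
  pose b := (\row_i chi (e i)) *m invmx P.
  have bP : b *m P = \row_i chi (e i) by rewrite mulmxKV.
  have chiE h : b *m (P *m regrep h *m invmx P) = chi h *: b.
    rewrite !mulmxA bP /b scalemxAl; congr (_ *m _).
    by apply/rowP => j; rewrite -[j]eK regrepE !mxE !oK chiM.
  have [i bi] : exists i, b 0 i != 0.
    apply: contrapT => /forallNP b0.
    have b00 : b = 0 by apply/rowP => i; rewrite [RHS]mxE; apply/eqP/negPn/negP.
    have := bP; rewrite b00 mul0mx => /rowP/(_ (o 1%g)); rewrite !mxE oK chi1.
    by move/eqP; rewrite eq_sym oner_eq0.
  exists (e i); apply/ffunP => h; rewrite XE eK -dE.
  have gin : regrep h \in [seq regrep g | g : G] by apply: map_f; rewrite mem_enum.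
  have /(diagonalizable_forP _ Pu) dg := Pd _ gin.
  have := congr1 (fun M : 'rV_n.+1 => M 0 i) (chiE h); rewrite /= [LHS]mxE [RHS]mxE.
  rewrite (bigD1 i) //= big1 ?addr0 => [|j ji]; last by rewrite dg ?mulr0.
  by rewrite mulrC => /(mulIf bi).
- pose v := \col_i a (e i).
  have v0 : P *m v = 0.
    apply/matrixP => i j; rewrite !mxE sum_o.
    transitivity (z i * \sum_g a g * X (e i) g); last by rewrite a0 mulr0.
    rewrite mulr_sumr; apply: eq_bigr => h _.
    by rewrite mxE oK XE eK PE -mulrA (mulrC _ (a h)).
  have : v = 0 by rewrite -[v](mulKmx Pu) v0 mulmx0.
  by move/matrixP/(_ (o g) 0); rewrite !mxE oK.
Qed.
End CharacterTable.

(** * Maps out of presented rings and base changes *)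

Section Lifts.
Definition make_additive (T V : zmodType) (f : T -> V) (fB : zmod_morphism f) :
    {additive T -> V} := HB.pack f (GRing.isZmodMorphism.Build T V f fB).

(** The relations only span the ideal as an additive group, so an additive map on
    the free group descends as soon as it kills each of them.  [zmodule M] is [M]
    with its canonical integer scaling, which [fext] requires. *)
Lemma presented_lift (X : monoidType) (rel : relations X) (M : zmodType)
    (f : X -> zmodule M) : (forall q, rel q -> fext f q = 0) ->
  exists F : {additive presented rel -> M}, forall x, F (pclass rel x) = f x.
Proof.
move=> f0; pose L : {linear monoid_ring X -> zmodule M} := fext f.
pose F (a : presented rel) : M := L (generic_quotient.repr a).
have Fproj q : F (pproj rel q) = L q.
  apply/eqP; rewrite -(subr_eq0 (_ : zmodule M)) -linearB.
  have /asboolP h :=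
    (pprojP rel (generic_quotient.repr (pproj rel q)) q).1 (generic_quotient.reprK _).
  apply: (h [pred a | L a == 0]) => [|a ra]; last by rewrite inE; apply/eqP/f0.
  split=> [|a b]; rewrite !inE ?linear0 // => /eqP a0 /eqP b0.
  by rewrite linearB a0 b0 subrr.
have FB : zmod_morphism F.
  move=> a b; have [p ->] := pproj_surj a; have [q ->] := pproj_surj b.
  by rewrite -pprojB !Fproj linearB.
by exists (make_additive FB) => x; rewrite /= Fproj /L /= fext_gen.
Qed.

Lemma base_change_lift (C : comNzRingType) (T : pzRingType) (f : {additive T -> C}) :
  exists F : {linear base_change C T -> C^o}, forall c t, F (bc c t) = c * f t.
Proof.
have [|F Fg] := @presented_lift _ (Relations (@biadditive_mull C T)
  (@biadditive_mulr C T)) C (fun x => x.1 * f x.2 : zmodule C).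
  move=> _ [c c' t|c t t']; rewrite !linearB /= !fext_gen /=.
    by rewrite mulrDl (addrAC (_ + _)) addrK subrr.
  by rewrite raddfD mulrDr (addrAC (_ + _)) addrK subrr.
have F_lin : linear (F : base_change C T -> C^o).
  move=> c a b; rewrite [LHS](raddfD F); congr (_ + _).
  elim/presented_ind: a => [|[d t]|a a' IH IH'].
  - by rewrite !scaler0 [LHS](raddf0 F) [F 0](raddf0 F) scaler0.
  - by rewrite -[pclass _ _]/(bc d t) bc_scaleE [LHS]Fg [F _]Fg /= -mulrA.
  - by rewrite scalerBr [LHS](raddfB F) IH IH' [F (_ - _)](raddfB F) scalerBr.
pose F' : {linear base_change C T -> C^o} := HB.pack (F : base_change C T -> C^o)
  (GRing.isLinear.Build C (base_change C T) C^o _ _ F_lin).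
by exists F' => c t; exact: Fg.
Qed.
End Lifts.

(** * Dual numbers *)

Section DualNumbers.
Variable C : fieldType.
Definition dual (a b : C) : {poly %/ ('X^2 : {poly C})} := in_qpoly 'X^2 (a%:P + b *: 'X).

Lemma dual_coef a b : (dual a b : {poly C})`_0 = a /\ (dual a b : {poly C})`_1 = b.
Proof.
have -> : (dual a b : {poly C}) = a%:P + b *: 'X.
  apply: in_qpoly_small; rewrite mk_monic_Xn // size_polyXn.
  apply: leq_ltn_trans (size_polyD _ _) _; rewrite gtn_max ltnS.
  rewrite (leq_trans (size_polyC_leq1 _)) //=.
  by apply: leq_ltn_trans (size_scale_leq _ _) _; rewrite size_polyX.
by rewrite !coefD !coefC !coefZ !coefX /= !(mulr0, mulr1, addr0, add0r).
Qed.

Lemma dual_surj (q : {poly %/ ('X^2 : {poly C})}) :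
  q = dual (q : {poly C})`_0 (q : {poly C})`_1.
Proof.
have [d0 d1] := dual_coef (q : {poly C})`_0 (q : {poly C})`_1.
have h (p : {poly %/ ('X^2 : {poly C})}) i : (p : {poly C})`_i.+2 = 0.
  have e : size (mk_monic ('X^2 : {poly C})) = 3%N by rewrite mk_monic_Xn // size_polyXn.
  apply: nth_default; have := size_mk_monic p.
  by rewrite [X in (_ < X)%N]e ltnS => /leq_trans; apply.
apply/val_inj/polyP => -[|[|i]]; [exact: esym d0|exact: esym d1|].
by rewrite [LHS](h q i) [RHS](h _ i).
Qed.

Lemma dual_linear c a b a' b' : dual (c * a + a') (c * b + b') = c *: dual a b + dual a' b'.
Proof.
rewrite /dual -in_qpolyZ -in_qpolyD; congr in_qpoly.
by rewrite polyCD polyCM scalerDr !scalerA scalerDl mul_polyC addrACA.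
Qed.

Lemma dual1 : dual 1 0 = 1.
Proof. by rewrite /dual scale0r addr0 in_qpoly1. Qed.

Lemma dualM a b a' b' : dual a b * dual a' b' = dual (a * a') (a * b' + b * a').
Proof.
rewrite /dual -in_qpolyM.
have -> : (a%:P + b *: 'X) * (a'%:P + b' *: 'X) =
    ((a * a')%:P + (a * b' + b * a') *: 'X) + (b * b') *: 'X^2 :> {poly C}.
  rewrite mulrDl !mulrDr -!mul_polyC !polyCD !polyCM expr2.
  ring.
rewrite in_qpolyD [X in _ + X](_ : _ = 0) ?addr0 //.
rewrite in_qpolyZ [in_qpoly _ _](_ : _ = 0) ?scaler0 //; apply/val_inj => /=.
by rewrite mk_monic_Xn Pdiv.RingMonic.rmodpp ?monicXn.
Qed.

Lemma dual_inj a b a' b' : dual a b = dual a' b' -> a = a' /\ b = b'.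
Proof.
have [a0 b0] := dual_coef a b; have [a1 b1] := dual_coef a' b'.
by move=> e; split; [rewrite -a0 e a1|rewrite -b0 e b1].
Qed.
End DualNumbers.

(** * Quadratic extensions of an integral group ring *)

Lemma enum_bij (T : finType) n : #|T| = n -> exists f : 'I_n -> T, bijective f.
Proof. by move=> <-; exists enum_val; exact: enum_val_bij. Qed.

Section IntegralCombinations.
Variables (G : finGroupType) (T : pzRingType) (e : G -> T).
Implicit Types u v w : {ffun G -> int}.

Definition zcomb u : T := \sum_g e g *~ u g.

Lemma zcombD u v : zcomb (u + v) = zcomb u + zcomb v.
Proof. by rewrite -big_split; apply: eq_bigr => g _; rewrite ffunE mulrzDr. Qed.
Lemma zcombB u v : zcomb (u - v) = zcomb u - zcomb v.
Proof.
rewrite zcombD; congr (_ + _); rewrite -sumrN.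
by apply: eq_bigr => g _; rewrite ffunE mulrNz.
Qed.
Lemma zcomb0 : zcomb 0 = 0.
Proof. by rewrite /zcomb big1 // => g _; rewrite ffunE mulr0z. Qed.
Lemma zcomb_delta g : zcomb [ffun x => (x == g)%:R] = e g.
Proof.
rewrite /zcomb (bigD1 g) //= ffunE eqxx mulr1z big1 ?addr0 // => x xg.
by rewrite ffunE (negPf xg) mulr0z.
Qed.

Hypotheses (e1 : e 1%g = 1) (eM : forall g h, e (g * h)%g = e g * e h).

Lemma zcombM u v : exists w, zcomb u * zcomb v = zcomb w.
Proof.
exists [ffun x => \sum_g u g * v (g^-1 * x)%g].
rewrite /zcomb mulr_suml; under [RHS]eq_bigr => x _ do rewrite ffunE mulrz_sumr.
rewrite exchange_big; apply: eq_bigr => g _ /=.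
rewrite mulr_sumr [RHS](reindex (fun x => g * x)%g) /=; last first.
  by exists (fun x => g^-1 * x)%g => x _ /=; rewrite ?mulKg ?mulKVg.
apply: eq_bigr => h _; rewrite mulKg eM mulrzAl mulrzAr.
by rewrite -mulrzA mulrC.
Qed.

Variable (p : T) (c : {ffun G -> int}).
Hypotheses (pC : forall g, p * e g = e g * p) (pp : p * p = zcomb c * p).

Lemma zcomb_comm u : p * zcomb u = zcomb u * p.
Proof.
rewrite /zcomb mulr_sumr mulr_suml; apply: eq_bigr => g _.
by rewrite mulrzAr mulrzAl pC.
Qed.

(** The square of [p] is brought back to the span by p^2 = c p. *)
Lemma span_subring : subring_closed (fun x => `[< exists u v, x = zcomb u + zcomb v * p >]).
Proof.
split=> [|x y /asboolP[u [v ->]] /asboolP[u' [v' ->]]|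
         x y /asboolP[u [v ->]] /asboolP[u' [v' ->]]]; apply/asboolP.
- by exists [ffun x => (x == 1%g)%:R], 0; rewrite zcomb_delta zcomb0 mul0r addr0 e1.
- by exists (u - u'), (v - v'); rewrite !zcombB mulrBl opprD addrACA.
have [w1 E1] := zcombM u u'; have [w2 E2] := zcombM u v'.
have [w3 E3] := zcombM v u'; have [w4 E4] := zcombM v v'; have [w5 E5] := zcombM w4 c.
exists w1, (w2 + w3 + w5); rewrite !zcombD -E1 -E2 -E3 -E5 -E4.
rewrite mulrDl !mulrDr !mulrDl -!addrA; congr (_ + _).
rewrite -!(mulrA (zcomb v)) (mulrA p) !zcomb_comm.
by rewrite -!mulrA pp.
Qed.
End IntegralCombinations.

Section Split.
Variables (C : fieldType) (G : finGroupType) (T : pzRingType).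
Variables (e : G -> T) (p : T) (c : {ffun G -> int}).
Local Notation E := (zcomb e).
Hypotheses (e1 : e 1%g = 1) (eM : forall g h, e (g * h)%g = e g * e h)
  (pC : forall g, p * e g = e g * p) (pp : p * p = E c * p)
  (E_span : forall t, exists u v, t = E u + E v * p)
  (E_free : forall u v, E u + E v * p = 0 -> u = 0 /\ v = 0).
Variable X : G -> {ffun G -> C}.
Hypotheses (X1 : forall i, X i 1%g = 1)
  (XM : forall i g h, X i (g * h)%g = X i g * X i h)
  (X_surj : forall f : G -> C, exists a : G -> C, forall i, \sum_g a g * X i g = f i)
  (X_free : forall a : G -> C, (forall i, \sum_g a g * X i g = 0) -> forall g, a g = 0).

Lemma span_ind (P : T -> Prop) : P 0 -> (forall t t', P t -> P t' -> P (t - t')) ->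
  (forall g, P (e g)) -> (forall g, P (e g * p)) -> forall t, P t.
Proof.
move=> P0 PB Pe Pep t.
have PN t' : P t' -> P (- t') by move=> Pt; rewrite -sub0r; apply: PB.
have PD t1 t2 : P t1 -> P t2 -> P (t1 + t2).
  by move=> h1 h2; rewrite -[t2]opprK; apply: PB => //; apply: PN.
have Pz t' (z : int) : P t' -> P (t' *~ z).
  move=> Pt; have Pn n : P (t' *+ n) by elim: n => // n IH; rewrite mulrS; apply: PD.
  by case: z => n; [exact: Pn | rewrite NegzE mulrNz; apply: PN; exact: Pn].
have [u [v ->]] := E_span t; apply: (PD).
  by rewrite /zcomb; apply: (big_ind P) => // g _; apply: Pz.
rewrite /zcomb mulr_suml; apply: (big_ind P) => // g _.
by rewrite mulrzAl; apply: Pz.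
Qed.

Lemma coordinates : exists U V : {additive T -> {ffun G -> int}},
  (forall t, t = E (U t) + E (V t) * p) /\
  forall u v, U (E u + E v * p) = u /\ V (E u + E v * p) = v.
Proof.
have /choice[UV UVE] : forall t, exists uv : {ffun G -> int} * {ffun G -> int},
    t = E uv.1 + E uv.2 * p.
  by move=> t; have [u [v ->]] := E_span t; exists (u, v).
have uniq_uv u v u' v' : E u + E v * p = E u' + E v' * p -> u = u' /\ v = v'.
  move/eqP; rewrite -subr_eq0 opprD addrACA -mulrBl -!zcombB => /eqP/E_free.
  by case=> /eqP; rewrite subr_eq0 => /eqP-> /eqP; rewrite subr_eq0 => /eqP->.
have uvB t t' : (UV (t - t')).1 = (UV t).1 - (UV t').1 /\
                (UV (t - t')).2 = (UV t).2 - (UV t').2.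
  by apply: uniq_uv; rewrite -UVE !zcombB mulrBl addrACA -opprD -!UVE.
have U_additive : zmod_morphism (fun t => (UV t).1) by move=> t t'; case: (uvB t t').
have V_additive : zmod_morphism (fun t => (UV t).2) by move=> t t'; case: (uvB t t').
exists (make_additive U_additive), (make_additive V_additive); split=> // u v.
by apply: uniq_uv; rewrite -UVE.
Qed.

Let ev i (u : {ffun G -> int}) : C := char_eval (X i) u.

(** Applying the character [X i] to both coordinates is the ring map from [T] to
    the quotient of C[x] by x^2 - X i (c) x that sends [p] to x: this is the
    multiplication law of the last two clauses. *)
Lemma evaluations : exists al be : G -> {additive T -> C},
  [/\ forall i, al i 1 = 1 /\ be i 1 = 0,
      forall i g, (al i (e g) = X i g /\ be i (e g) = 0) /\
                  (al i (e g * p) = 0 /\ be i (e g * p) = X i g),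
      forall i t t', al i (t * t') = al i t * al i t' &
      forall i t t', be i (t * t') =
        al i t * be i t' + be i t * al i t' + ev i c * (be i t * be i t')].
Proof.
have [U [V [UVE UVK]]] := coordinates.
have ev_additive i : zmod_morphism (ev i).
  move=> u v; rewrite /ev /char_eval -sumrB; apply: eq_bigr => g _.
  by rewrite !ffunE rmorphB mulrBl.
pose d g : {ffun G -> int} := [ffun x => (x == g)%:R].
have Ed g : E (d g) = e g by exact: zcomb_delta.
have evd i g : ev i (d g) = X i g.
  rewrite /ev /char_eval (bigD1 g) //= ffunE eqxx mul1r big1 ?addr0 // => x xg.
  by rewrite ffunE (negPf xg) mul0r.
have E0 : E 0 = 0 by exact: zcomb0.
have Ue g : U (e g) = d g /\ V (e g) = 0.
  by rewrite -(Ed g) -[E _]addr0 -(mul0r p) -E0; apply: UVK.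
have Vep g : U (e g * p) = 0 /\ V (e g * p) = d g.
  by rewrite -(Ed g) -[_ * p]add0r -E0; apply: UVK.
pose evA i := make_additive (ev_additive i).
pose al i : {additive T -> C} := evA i \o U; pose be i : {additive T -> C} := evA i \o V.
have ale i g : al i (e g) = X i g by rewrite /= (Ue g).1 evd.
have bee i g : be i (e g) = 0 by rewrite /= (Ue g).2; exact: (raddf0 (evA i)).
have alp i g : al i (e g * p) = 0 by rewrite /= (Vep g).1; exact: (raddf0 (evA i)).
have bep i g : be i (e g * p) = X i g by rewrite /= (Vep g).2 evd.
clearbody al be.
have law i t t' : al i (t * t') = al i t * al i t' /\
    be i (t * t') = al i t * be i t' + be i t * al i t' + ev i c * (be i t * be i t').
  have epp g h : e g * p * (e h * p) = e (g * h)%g * E c * p.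
    by rewrite -!mulrA (mulrA p) pC -!mulrA pp !mulrA eM.
  (* Both sides are biadditive, so it suffices to compare them on the basis. *)
  elim/span_ind: t => [|t1 t2 [IH1 IH1'] [IH2 IH2']|g|g].
  - by rewrite !mul0r !raddf0 !(mul0r, mulr0, addr0).
  - by rewrite mulrBl !raddfB IH1 IH1' IH2 IH2'; split; ring.
  - elim/span_ind: t' => [|t1 t2 [IH1 IH1'] [IH2 IH2']|h|h].
    + by rewrite !mulr0 !raddf0 !(mul0r, mulr0, addr0).
    + by rewrite mulrBr !raddfB IH1 IH1' IH2 IH2'; split; ring.
    + by rewrite -eM !ale !bee XM !(mul0r, mulr0, addr0).
    + by rewrite mulrA -eM !ale !bee !alp !bep XM !(mul0r, mulr0, addr0).
  - elim/span_ind: t' => [|t1 t2 [IH1 IH1'] [IH2 IH2']|h|h].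
    + by rewrite !mulr0 !raddf0 !(mul0r, mulr0, addr0).
    + by rewrite mulrBr !raddfB IH1 IH1' IH2 IH2'; split; ring.
    + by rewrite -mulrA pC mulrA -eM !ale !bee !alp !bep XM !(mul0r, mulr0, addr0, add0r).
    + rewrite epp !alp !bep /zcomb mulr_sumr mulr_suml !raddf_sum.
      rewrite !(mul0r, mulr0, addr0, add0r); split.
        by rewrite big1 // => x _; rewrite mulrzAr mulrzAl raddfMz /= -eM alp mul0rz.
      rewrite -XM /ev /char_eval mulr_suml; apply: eq_bigr => x _.
      by rewrite mulrzAr mulrzAl raddfMz /= -eM bep !XM -mulrzl; ring.
exists al, be; split=> // [i|i t t'|i t t'].
- by rewrite -e1 ale bee X1.
- by case: (law i t t').
- by case: (law i t t').
Qed.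

(** The values [A i x], [B i x], for all [i], determine [x] and can be prescribed
    at will because the character table is invertible. *)
Lemma base_change_evaluations : exists A B : G -> {linear base_change C T -> C^o},
  [/\ forall i, A i 1 = 1 /\ B i 1 = 0,
      forall i x y, A i (x * y) = A i x * A i y,
      forall i x y, B i (x * y) =
        A i x * B i y + B i x * A i y + ev i c * (B i x * B i y),
      forall x, (forall i, A i x = 0 /\ B i x = 0) -> x = 0 &
      forall f g : G -> C, exists x, forall i, A i x = f i /\ B i x = g i].
Proof.
have [al [be [al1 albe alM beM]]] := evaluations.
have /choice[A AE] := fun i => base_change_lift (al i).
have /choice[B BE] := fun i => base_change_lift (be i).
pose comb (a b : G -> C) : base_change C T :=
  \sum_g a g *: bc 1 (e g) + \sum_g b g *: bc 1 (e g * p).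
have AB i a b : A i (comb a b) = \sum_g a g * X i g /\ B i (comb a b) = \sum_g b g * X i g.
  rewrite /comb !linearD !linear_sum.
  split; [rewrite [X in _ + X]big1 ?addr0|rewrite [X in X + _]big1 ?add0r] => [|g _||g _].
  - by apply: eq_bigr => g _; rewrite linearZ /= AE mul1r (albe i g).1.1.
  - by rewrite linearZ /= AE (albe i g).2.1 mulr0 scaler0.
  - by apply: eq_bigr => g _; rewrite linearZ /= BE mul1r (albe i g).2.2.
  - by rewrite linearZ /= BE (albe i g).1.2 mulr0 scaler0.
have combB a b a' b' :
    comb a b - comb a' b' = comb (fun g => a g - a' g) (fun g => b g - b' g).
  rewrite /comb opprD addrACA -!sumrB.
  by congr (_ + _); apply: eq_bigr => g _; rewrite scalerBl.
have comb0 a b : (forall g, a g = 0) -> (forall g, b g = 0) -> comb a b = 0.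
  by move=> a0 b0; rewrite /comb !big1 ?addr0 // => g _; rewrite ?a0 ?b0 scale0r.
have comb_span x : exists a b, x = comb a b.
  elim/presented_ind: x => [|[z t]|x y [a [b ->]] [a' [b' ->]]].
  - by exists (fun=> 0), (fun=> 0); rewrite comb0.
  - rewrite -[pclass _ _]/(bc z t).
    have bcB (u u' : T) : bc z (u - u') = bc z u - bc z u'.
      by apply: (addIr (bc z u')); rewrite -bcDr !subrK.
    have delta (Y : G -> base_change C T) g : z *: Y g = \sum_h (z * (h == g)%:R) *: Y h.
      rewrite (bigD1 g) //= eqxx mulr1 big1 ?addr0 // => h hg.
      by rewrite (negPf hg) mulr0 scale0r.
    have zero (Y : G -> base_change C T) : \sum_h 0 *: Y h = 0.
      by rewrite big1 // => h _; rewrite scale0r.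
    elim/span_ind: t => [|t t' [a [b aE]] [a' [b' aE']]|g|g].
    + exists (fun=> 0), (fun=> 0); rewrite comb0 //.
      by have := bcB 0 0; rewrite !subrr.
    + by do 2!eexists; rewrite bcB aE aE' combB.
    + exists (fun h => z * (h == g)%:R), (fun=> 0).
      by rewrite /comb zero addr0 -(delta (fun h => bc 1 (e h))) bc_scaleE mulr1.
    + exists (fun=> 0), (fun h => z * (h == g)%:R).
      by rewrite /comb zero add0r -(delta (fun h => bc 1 (e h * p))) bc_scaleE mulr1.
  - by do 2!eexists; rewrite combB.
have law i x y : A i (x * y) = A i x * A i y /\
    B i (x * y) = A i x * B i y + B i x * A i y + ev i c * (B i x * B i y).
  elim/presented_ind: x => [|[z t]|x x' [IH1 IH1'] [IH2 IH2']].
  - by rewrite !mul0r !linear0 !(mul0r, mulr0, addr0).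
  - rewrite -[pclass _ _]/(bc z t).
    elim/presented_ind: y => [|[z' t']|y y' [IH1 IH1'] [IH2 IH2']].
    + by rewrite !mulr0 !linear0 !(mul0r, mulr0, addr0).
    + by rewrite -[pclass _ _]/(bc z' t') bcM !AE !BE alM beM; split; ring.
    + by rewrite mulrBr !linearB /= IH1 IH1' IH2 IH2'; split; ring.
  - by rewrite mulrBl !linearB /= IH1 IH1' IH2 IH2'; split; ring.
exists A, B; split=> [i|i x y|i x y|x x0|f g].
- by have [a1 b1] := al1 i; rewrite -[1]/(bc 1 1) AE BE a1 b1 mulr1 mulr0.
- by case: (law i x y).
- by case: (law i x y).
- have [a [b xE]] := comb_span x; rewrite xE comb0 //; apply: X_free => i.
    by have [] := x0 i; rewrite xE (AB i a b).1.
  by have [_] := x0 i; rewrite xE (AB i a b).2.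
- have [a aE] := X_surj f; have [b bE] := X_surj g.
  by exists (comb a b) => i; rewrite (AB i a b).1 (AB i a b).2 aE bE.
Qed.

(** The factor of the character [X i] is C[x] / (x^2 - a x) with a = X i (c).  When
    a <> 0 it is C x C by evaluation at x = 0 and x = a; otherwise x is the
    generator of the dual numbers. *)
Lemma base_change_split r s : #|G| = s -> #|[pred i | char_eval (X i) c != 0]| = r ->
  exists phi : base_change C T ->
      ({ffun 'I_(2 * r) -> C^o} * {ffun 'I_(s - r) -> {poly %/ ('X^2 : {poly C})}})%type,
    [/\ bijective phi, linear phi & monoid_morphism phi].
Proof.
move=> cG cr; have [A [B [AB1 AM BM AB_inj AB_surj]]] := base_change_evaluations.
pose I1 := {i | ev i c != 0}; pose I0 := {i | ~~ (ev i c != 0)}.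
have [k1 k1_bij] : exists k1 : 'I_(2 * r) -> (bool * I1)%type, bijective k1.
  by apply: enum_bij; rewrite card_prod card_bool card_sig cr.
have [k0 k0_bij] : exists k0 : 'I_(s - r) -> I0, bijective k0.
  by apply: enum_bij; rewrite card_sig -cG -cr -(cardC [pred i | ev i c != 0]) addKn.
have [l1 k1K l1K] := k1_bij; have [l0 k0K l0K] := k0_bij.
pose w (b : bool) i x := if b then A i x + ev i c * B i x else A i x.
pose phi x : {ffun 'I_(2 * r) -> C^o} * {ffun 'I_(s - r) -> {poly %/ ('X^2 : {poly C})}} :=
  ([ffun j => w (k1 j).1 (val (k1 j).2) x],
   [ffun j => dual (A (val (k0 j)) x) (B (val (k0 j)) x)]).
have phi_lin : linear phi.
  move=> z x y; congr pair; apply/ffunP => j; rewrite !ffunE.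
    by rewrite /w; case: (k1 j).1; rewrite !linearP //= -![z *: _]/(z * _); ring.
  by rewrite !linearP dual_linear.
have phi_mul : monoid_morphism phi.
  split=> [|x y]; congr pair; apply/ffunP => j; rewrite !ffunE.
  - by rewrite /w; have [-> ->] := AB1 (val (k1 j).2); rewrite mulr0 addr0 if_same.
  - by have [-> ->] := AB1 (val (k0 j)); rewrite dual1.
  - by rewrite /w; case: (k1 j).1; rewrite AM ?BM //=; ring.
  - by rewrite AM BM (eqP (negbNE (valP (k0 j)))) mul0r addr0 dualM.
have phi_inj x : phi x = 0 -> x = 0.
  move=> [/ffunP x1 /ffunP x0]; apply: AB_inj => i.
  have [ic|ic] := boolP (ev i c != 0).
    have Ai : A i x = 0 by have := x1 (l1 (false, Sub i ic)); rewrite !ffunE l1K.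
    split=> //; have := x1 (l1 (true, Sub i ic)); rewrite !ffunE l1K /w /= Ai add0r.
    by move/eqP; rewrite mulf_eq0 (negPf ic) => /eqP.
  have := x0 (l0 (Sub i ic)); rewrite !ffunE l0K /=.
  rewrite (_ : 0 = dual 0 0); first exact: dual_inj.
  by rewrite /dual scale0r addr0 in_qpoly0.
have phi_surj y : exists x, phi x = y.
  (* When a <> 0, the values at x = 0 and x = a of a polynomial of degree at most
     one give back its coefficients. *)
  pose f i : C := if insub i is Some i1 then y.1 (l1 (false, (i1 : I1))) else
    if insub i is Some i0 then (y.2 (l0 (i0 : I0)) : {poly C})`_0 else 0.
  pose g i : C := if insub i is Some i1 then
      (y.1 (l1 (true, (i1 : I1))) - y.1 (l1 (false, i1))) / ev i c else
    if insub i is Some i0 then (y.2 (l0 (i0 : I0)) : {poly C})`_1 else 0.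
  have [x xE] := AB_surj f g; exists x; case: y @f @g xE => y1 y0 /= xE.
  congr pair; apply/ffunP => j; rewrite !ffunE.
    have [Ai Bi] := xE (val (k1 j).2); rewrite /w Ai Bi valK.
    rewrite [_ * (_ / _)]mulrC divfK ?(valP (k1 j).2) // addrC subrK -fun_if.
    by rewrite -[in RHS](k1K j); case: (k1 j) => -[].
  have no1 : insub (val (k0 j)) = None :> option I1.
    by apply: insubF; apply: negbTE; exact: valP (k0 j).
  by have [-> ->] := xE (val (k0 j)); rewrite no1 valK k0K -dual_surj.
exists phi; split=> //; have /choice[psi psiK] := phi_surj.
exists psi => // x; apply/eqP; rewrite -subr_eq0; apply/eqP/phi_inj.
have phiB u v : phi (u - v) = phi u - phi v.
  by rewrite addrC -scaleN1r phi_lin scaleN1r addrC.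
by rewrite phiB psiK subrr.
Qed.
End Split.

(** * Submodules, quotients and simple quotients *)

Section LinearAlgebra.
Variable k : fieldType.

Lemma epiP m n (f : 'M[k]_(m, n)) : epi f <-> exists s, f *m s = 1%:M.
Proof.
split=> [ef|[s fs] w]; last by exists (s *m w); rewrite mulmxA fs mul1mx.
have /choice[s sE] := fun j : 'I_m => ef (col j 1%:M).
exists (\matrix_(i, j) s j i 0); apply/matrixP => i j.
have /matrixP/(_ i 0) := sE j; rewrite !mxE => <-.
by apply: eq_bigr => l _; rewrite mxE.
Qed.

Lemma monoP m n (f : 'M[k]_(m, n)) : mono f <-> exists l, l *m f = 1%:M.
Proof.
split=> [mf|[l lf] v fv0]; last by rewrite -[v]mul1mx -lf -mulmxA fv0 mulmx0.
have /row_freeP[B fB] : row_free f^T.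
  rewrite -kermx_eq0; apply/eqP/row_matrixP => i; rewrite row0.
  apply: trmx_inj; rewrite trmx0; apply: mf.
  by apply: trmx_inj; rewrite trmx_mul trmxK trmx0 -row_mul mulmx_ker row0.
by exists B^T; rewrite -[f]trmxK -trmx_mul fB trmx1.
Qed.

Lemma epi_row n (w : 'rV[k]_n) : w != 0 -> epi w.
Proof.
case/rV0Pn => j wj; apply/epiP; exists (\col_i ((i == j)%:R / w 0 j)).
apply/matrixP => i i'; rewrite !ord1 !mxE (bigD1 j) //= mxE eqxx mul1r divff //.
by rewrite big1 ?addr0 // => l lj; rewrite mxE (negPf lj) mul0r mulr0.
Qed.

Lemma epi_neq0 m n (f : 'M[k]_(m.+1, n)) : epi f -> f != 0.
Proof.
move=> /epiP[s]; apply: contra_eq_neq => ->; rewrite mul0mx; apply/eqP.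
by move/matrixP/(_ 0 0)/eqP; rewrite !mxE eqxx eq_sym oner_eq0.
Qed.

Lemma epi_dim m n (f : 'M[k]_(m, n)) : epi f -> (m <= n)%N.
Proof. by case/epiP => s; apply: mulmx1_min. Qed.

(** A subspace of maximal dimension among those contained in [F] is all of [F]. *)
Lemma subspace_matrix n (F : 'rV[k]_n -> Prop) :
  F 0 -> (forall c v w, F v -> F w -> F (c *: v + w)) ->
  exists U : 'M[k]_n, forall v, F v <-> (v <= U)%MS.
Proof.
move=> F0 FD; pose P d :=
  `[< exists U : 'M[k]_n, \rank U = d /\ forall v, (v <= U)%MS -> F v >].
have P0 : exists d, P d.
  by exists 0%N; apply/asboolP; exists 0; split=> [|v]; rewrite ?mxrank0 // submx0 => /eqP->.
have Pn d : P d -> (d <= n)%N by move=> /asboolP[U [<- _]]; apply: rank_leq_row.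
case: (ex_maxnP P0 Pn) => d /asboolP[U [Ud UF]] dmax.
exists U => v; split; last exact: UF.
move=> Fv; apply/negPn/negP => vU.
have /dmax : P (\rank (U + v)%MS).
  apply/asboolP; exists (U + v)%MS; split=> // w /sub_addsmxP[[a b] /= ->].
  rewrite addrC [b]mx11_scalar mul_scalar_mx; apply: FD => //; apply: UF; exact: submxMl.
rewrite -Ud leqNgt => /negP; apply; apply: rank_ltmx.
by rewrite ltmxE addsmxSl addsmx_sub submx_refl.
Qed.
End LinearAlgebra.

Section Modules.
Variables (k : fieldType) (A : falgType k).
Implicit Types X Y Z P Q K : amod A.

Definition make_act n (f : A -> 'M[k]_n) (fl : linear f) (fm : monoid_morphism f) :
    {lrmorphism A -> 'M[k]_n} :=
  HB.pack f (GRing.isLinear.Build k A 'M[k]_n _ f fl)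
    (GRing.isMonoidMorphism.Build A 'M[k]_n f fm).

Lemma actM X a b : mact X (a * b) = mact X a *m mact X b.
Proof. exact: rmorphM. Qed.
Lemma act1 X : mact X 1 = 1%:M.
Proof. exact: rmorph1. Qed.

(** Modules act on columns, so a space of rows stable under the action is the dual
    of a quotient module; a basis of it is the matrix of the projection. *)
Lemma quotient_module X m (W : 'M[k]_(m, mdim X)) :
  (forall a, (W *m mact X a <= W)%MS) ->
  exists Z (w : 'M_(mdim Z, mdim X)), [/\ is_hom X Z w, epi w & mdim Z = \rank W].
Proof.
move=> WX; pose w := row_base W; have wf : row_free w by exact: row_base_free.
pose f a := w *m mact X a *m pinvmx w.
have fE a : f a *m w = w *m mact X a.
  by apply: mulmxKpV; rewrite !eq_row_base (eqmxMr _ (eq_row_base W)).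
have fl : linear f.
  by move=> c a b; rewrite /f linearP /= mulmxDr -scalemxAr mulmxDl -scalemxAl.
have fm : monoid_morphism f.
  split=> [|a b]; first by rewrite /f act1 mulmx1 mulmxVp.
  rewrite -[RHS]/(f a *m (w *m mact X b *m pinvmx w)).
  by rewrite {1}/f actM (mulmxA w) -fE !mulmxA.
exists (AMod (make_act fl fm)), w; split=> [a||//] /=; first by rewrite fE.
apply/epiP; have [s ws] := row_freeP wf; exists s. exact: ws.
Qed.

Lemma kernel_module X Z (f : 'M_(mdim Z, mdim X)) : is_hom X Z f ->
  exists K (j : 'M_(mdim X, mdim K)),
    [/\ is_hom K X j, mono j &
        forall v : 'cV_(mdim X), f *m v = 0 <-> exists u, j *m u = v].
Proof.
move=> hf; pose N := row_base (kermx f^T); have Nf : row_free N by exact: row_base_free.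
have Nker : N *m f^T = 0 by apply/sub_kermxP; rewrite eq_row_base.
pose B a := N *m (mact X a)^T *m pinvmx N.
have BE a : B a *m N = N *m (mact X a)^T.
  apply: mulmxKpV; rewrite eq_row_base; apply/sub_kermxP.
  by rewrite -mulmxA -trmx_mul hf trmx_mul mulmxA Nker mul0mx.
have fl : linear (fun a => (B a)^T).
  move=> c a b; rewrite /B [mact X _]linearP /= linearP /= mulmxDr -scalemxAr.
  by rewrite mulmxDl -scalemxAl linearP.
have fm : monoid_morphism (fun a => (B a)^T).
  split=> [|a b]; first by rewrite /B act1 trmx1 mulmx1 mulmxVp // trmx1.
  rewrite -[RHS]/((B a)^T *m (B b)^T) -trmx_mul; congr (_^T).
  rewrite {1}/B actM trmx_mul (mulmxA N) -BE -!mulmxA; congr (_ *m _).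
  by rewrite /B !mulmxA.
exists (AMod (make_act fl fm)), N^T; split=> [a||v] /=.
- by rewrite -trmx_mul BE trmx_mul trmxK.
- by apply/monoP; have [s Ns] := row_freeP Nf; exists s^T; rewrite -trmx_mul Ns trmx1.
split=> [fv|[u <-]]; last first.
  rewrite mulmxA (_ : f *m _ = 0) ?mul0mx //; apply: trmx_inj.
  by rewrite trmx_mul trmxK Nker trmx0.
have : (v^T <= N)%MS.
  by rewrite eq_row_base; apply/sub_kermxP; rewrite -trmx_mul fv trmx0.
by case/submxP => u uE; exists u^T; rewrite -trmx_mul -uE trmxK.
Qed.

(** A nonzero quotient [Z] of least dimension is simple: the rows that vanish on a
    proper nonzero submodule of [Z] would give a smaller one. *)
Lemma simple_quotient X : mdim X <> 0%N ->
  exists Z (w : 'M_(mdim Z, mdim X)), [/\ simple Z, is_hom X Z w & epi w].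
Proof.
move=> X0; pose P d := `[< exists Z (w : 'M_(mdim Z, mdim X)),
  [/\ is_hom X Z w, epi w, mdim Z = d & d <> 0%N] >].
have P0 : exists d, P d.
  exists (mdim X); apply/asboolP; exists X, 1%:M; split=> // [a|].
    by rewrite mul1mx mulmx1.
  by apply/epiP; exists 1%:M; rewrite mul1mx.
case: (ex_minnP P0) => d /asboolP[Z [w [hw ew Zd d0]]] dmin.
exists Z, w; split=> //; split=> [|U UZ]; first by rewrite Zd.
pose M : 'M[k]_(mdim Z, \dim U) := \matrix_(i, j) (vbasis U)`_j i 0.
have ME (x : 'cV_(\dim U)) : M *m x = \sum_j x j 0 *: (vbasis U)`_j.
  apply/colP => i; rewrite summxE mxE; apply: eq_bigr => j _.
  by rewrite !mxE mulrC.
have MU v : v \in U <-> exists x, v = M *m x.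
  split=> [vU|[x ->]].
    exists (\col_j coord (vbasis U) j v); rewrite ME [LHS](coord_vbasis vU).
    by apply: eq_bigr => j _; rewrite mxE.
  rewrite ME; apply: rpred_sum => j _; apply: rpredZ.
  by apply: vbasis_mem; rewrite mem_nth // size_tuple.
have Wmod a : (kermx M *m mact Z a <= kermx M)%MS.
  apply/sub_kermxP; apply/matrixP => i j; rewrite -mulmxA [RHS]mxE.
  have /MU[x xE] : mact Z a *m (vbasis U)`_j \in U.
    by apply: UZ; apply: vbasis_mem; rewrite mem_nth // size_tuple.
  have Mj : col j M = (vbasis U)`_j.
    by apply/colP => l; rewrite !mxE.
  rewrite -Mj in xE.
  have : col j (kermx M *m (mact Z a *m M)) = 0.
    rewrite colE -(mulmxA (kermx M)) -(mulmxA (mact Z a)) -colE xE.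
    by rewrite (mulmxA (kermx M)) mulmx_ker mul0mx.
  by move/colP/(_ i); rewrite !mxE.
have [Z' [w' [hw' ew' Z'd]]] := quotient_module Wmod.
have rM : \rank (kermx M) = (d - \rank M)%N by rewrite -Zd mxrank_ker.
have [rM0|rMd] : (\rank M = 0 \/ \rank M = d)%N.
  have [?|/eqP rM0] := eqVneq (\rank M) 0%N; [by left|right].
  apply/eqP; rewrite eqn_leq -{1}Zd rank_leq_row /= -subn_eq0 -rM.
  apply/negPn/negP => k0; have := dmin (\rank (kermx M)).
  rewrite rM leqNgt ltn_subrL !lt0n (_ : d != 0%N) ?andbT; last exact/eqP.
  move=> h; apply: rM0; apply/eqP/negPn; apply: h; apply/asboolP.
  exists Z', (w' *m w); split; [exact: hom_comp hw hw'| |by rewrite Z'd rM|].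
    have [s ws] := (epiP _).1 ew; have [s' ws'] := (epiP _).1 ew'.
    by apply/epiP; exists (s *m s'); rewrite -mulmxA (mulmxA w) ws mul1mx.
  by rewrite -rM; apply/eqP.
- left; apply/eqP; rewrite -subv0; apply/subvP => v /MU[x ->].
  by have /eqP := rM0; rewrite mxrank_eq0 => /eqP->; rewrite mul0mx mem0v.
- right; apply/eqP; rewrite eqEsubv subvf /=; apply/subvP => v _; apply/MU.
  have /row_fullP/=[] : row_full M^T by rewrite /row_full mxrank_tr rMd Zd.
  move=> B BM; exists (B^T *m v); rewrite mulmxA (_ : M *m _ = 1%:M) ?mul1mx //.
  by apply: trmx_inj; rewrite trmx_mul trmxK BM trmx1.
Qed.
End Modules.

(** * Split sequences and projective covers *)

Section SplitSequences.
Variables (k : fieldType) (A : falgType k).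
Implicit Types X Y Z P Q K : amod A.

Lemma iso_mdim X Y : iso X Y -> mdim X = mdim Y.
Proof.
move=> [f [g [_ _ gf fg]]]; apply/eqP.
by rewrite eqn_leq (mulmx1_min gf) (mulmx1_min fg).
Qed.

Lemma retract_section0 m n p
    (f : 'M[k]_(n, m)) (g : 'M_(p, n)) (q : 'M_(m, n)) (s : 'M_(n, p)) :
  q *m f = 1%:M -> g *m s = 1%:M -> f *m q + s *m g = 1%:M -> q *m s = 0.
Proof.
move=> qf gs fq; apply: (addIr (q *m s)); rewrite add0r.
rewrite -[in RHS](mulmx1 q) -fq mulmxDr mulmxDl !mulmxA qf mul1mx.
by rewrite -[_ *m g *m s]mulmxA gs mulmx1.
Qed.

Lemma split_exact_sym X1 X2 X3 : split_exact X1 X2 X3 -> split_exact X3 X2 X1.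
Proof.
case/split_exactP=> [f [g [q [s [[hf hg hq hs] [qf gs gf fq]]]]]].
apply: (split_exactI hs hq hf gs qf); last by rewrite addrC.
exact: retract_section0 qf gs fq.
Qed.

Lemma split_exact0 X : mdim X = 0%N -> split_exact X X X.
Proof.
move=> X0; have triv (M N : 'M[k]_(mdim X)) : M = N.
  by apply/matrixP => -[m mX]; exfalso; have := mX; rewrite X0.
by apply: (@split_exactI _ _ X X X 1%:M 1%:M 1%:M 1%:M) => // [a|a|a|||]; apply: triv.
Qed.

Lemma split_exact_mdim X1 X2 X3 : split_exact X1 X2 X3 -> mdim X2 = (mdim X1 + mdim X3)%N.
Proof.
move=> sX; case/split_exactP: (sX)=> [f [g [q [s [[hf hg hq hs] [qf gs gf fq]]]]]].
have qs := retract_section0 qf gs fq.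
apply/eqP; rewrite eqn_leq; apply/andP; split.
  by apply: (@mulmx1_min _ _ _ (row_mx f s) (col_mx q g)); rewrite mul_row_col.
apply: (@mulmx1_min _ _ _ (col_mx q g) (row_mx f s)).
by rewrite mul_col_row qf gs gf qs -scalar_mx_block.
Qed.

Lemma exact_projective_split X1 X2 X3
    (f : 'M_(mdim X2, mdim X1)) (g : 'M_(mdim X3, mdim X2)) :
  @exact_seq _ _ X1 X2 X3 f g -> projective X3 -> split_exact X1 X2 X3.
Proof.
move=> ex prX3; exists f, g; split=> //; case: ex => hf hg mf eg _.
by apply: prX3 hg eg _ => a; rewrite mul1mx mulmx1.
Qed.

(** As vector spaces every exact sequence splits; unlike the maps of a module
    splitting, these [q] and [s] need not commute with the action. *)
Lemma linear_splitting X1 X2 X3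
    (f : 'M_(mdim X2, mdim X1)) (g : 'M_(mdim X3, mdim X2)) :
  @exact_seq _ _ X1 X2 X3 f g ->
  exists q s, [/\ q *m f = 1%:M, g *m s = 1%:M, g *m f = 0 & f *m q + s *m g = 1%:M].
Proof.
move=> [hf hg mf eg ex].
have [s gs] := (epiP g).1 eg; have [q0 q0f] := (monoP f).1 mf.
have gf : g *m f = 0.
  apply/matrixP => i j.
  have /ex : exists u, f *m u = col j f by exists (delta_mx j 0); rewrite colE.
  by rewrite colE mulmxA -colE => /matrixP/(_ i 0); rewrite !mxE.
have gM : g *m (1%:M - s *m g) = 0 by rewrite mulmxBr mulmxA gs mulmx1 mul1mx subrr.
have /choice[N0 N0E] : forall j, exists u, f *m u = col j (1%:M - s *m g).
  by move=> j; apply/ex; rewrite colE mulmxA gM mul0mx.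
have [N NE] : exists N, f *m N = 1%:M - s *m g.
  exists (\matrix_(i, j) N0 j i 0); apply/matrixP => i j.
  have /matrixP/(_ i 0) := N0E j; rewrite !mxE => <-.
  by apply: eq_bigr => l _; rewrite mxE.
exists N, s; split=> //; last by rewrite NE subrK.
by rewrite -[N]mul1mx -q0f -!mulmxA (mulmxA f) NE mulmxBl -mulmxA gf mulmx0 subr0 mul1mx.
Qed.

Lemma projective_retract P Q i r : is_hom P Q i -> is_hom Q P r -> r *m i = 1%:M ->
  projective Q -> projective P.
Proof.
move=> hi hr ri prQ Y Z p f hp ep hf.
have [g [hg pg]] := prQ _ _ _ _ hp ep (hom_comp hr hf).
by exists (g *m i); split; [exact: hom_comp hi hg | rewrite mulmxA pg -mulmxA ri mulmx1].
Qed.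

Lemma projective_iso P Q : iso P Q -> projective P -> projective Q.
Proof. by move=> [f [g [hf hg gf fg]]]; apply: projective_retract hg hf fg. Qed.

Lemma cover_iso P X Y : iso X Y -> projective_cover P X -> projective_cover P Y.
Proof.
move=> [f [g [hf hg gf fg]]] [prP [p [hp ep essp]]]; split=> //.
exists (f *m p); split; first exact: hom_comp hp hf.
  by move=> w; have [v pv] := ep (g *m w); exists v; rewrite -mulmxA pv mulmxA fg mul1mx.
move=> Z h hh eph; apply: essp hh _ => w; have [v vE] := eph (f *m w).
by exists v; rewrite -[RHS]mul1mx -gf -[RHS]mulmxA -vE !mulmxA gf mul1mx.
Qed.

Lemma kernel_exact X Z (f : 'M_(mdim Z, mdim X)) : is_hom X Z f -> epi f ->
  exists K (j : 'M_(mdim X, mdim K)), @exact_seq _ _ K X Z j f.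
Proof.
by move=> hf ef; have [K [j [hj mj jE]]] := kernel_module hf; exists K, j.
Qed.

(** A lift of [p] through the cover is onto because the cover is essential, and it
    splits because the cover is projective. *)
Lemma cover_summand P Z Q p : projective_cover P Z -> projective Q ->
  is_hom Q Z p -> epi p -> exists2 K, split_exact K Q P & projective K.
Proof.
move=> [prP [q [hq eq essq]]] prQ hp ep.
have [h [hh qh]] := prQ _ _ _ _ hq eq hp.
have eh : epi h by apply: essq hh _; rewrite qh.
have [K [j ex]] := kernel_exact hh eh; have sK := exact_projective_split ex prP.
exists K => //; have [f [g [r [s [[hf hg hr hs] [rf _ _ _]]]]]] := split_exactP sK.
exact: projective_retract hf hr rf prQ.
Qed.

Lemma simple_mdim1 X : mdim X = 1%N -> simple X.
Proof.
move=> X1; split=> [|U _]; first by rewrite X1.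
have [->|Un0] := eqVneq U 0%VS; [by left | right].
apply/eqP; rewrite eqEdim subvf dimvf /= dim_matrix /=.
by apply: (@leq_trans 1); [rewrite X1 | rewrite lt0n dimv_eq0].
Qed.
End SplitSequences.

Section Twist.
Variables (k : fieldType) (A : falgType k) (tau tau' : {lrmorphism A -> A}).
Hypotheses (tauK : cancel tau tau') (tau'K : cancel tau' tau).

(** A lifting problem over [tau] becomes one for [P] after restriction along [tau']. *)
Lemma restriction_projective (P : amod A) : projective P -> projective (restriction tau P).
Proof.
move=> prP Y Z p f hp ep hf.
have [|||g [hg pg]] := prP (restriction tau' Y) (restriction tau' Z) p f.
- by move=> a; apply: hp.
- exact: ep.
- by move=> a; rewrite -[in LHS](tau'K a); apply: hf.
by exists g; split=> // a; have := hg (tau a); rewrite /= tauK.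
Qed.

Lemma restriction_cover (P X : amod A) :
  projective_cover P X -> projective_cover (restriction tau P) (restriction tau X).
Proof.
move=> [prP [p [hp ep essp]]]; split; first exact: restriction_projective.
exists p; split=> // [a|Y f hf epf]; first exact: hp.
apply: (essp (restriction tau' Y)) => // a.
by rewrite /= -[in RHS](tau'K a); apply: hf.
Qed.
End Twist.

(** * Additive invariants *)

Section Subfunctor.
Variables (k : fieldType) (A : falgType k).
Implicit Types X Y : amod A.

(** The ambient contravariant functor sends [X] to its space of linear forms. *)
Definition subfunctor (F : forall X, 'rV[k]_(mdim X) -> Prop) :=
  [/\ forall X, F X 0, forall X c v w, F X v -> F X w -> F X (c *: v + w) &
      forall X Y f v, is_hom X Y f -> F Y v -> F X (v *m f)].

(** The value of a subfunctor on a direct sum is the direct sum of its values, so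
    its dimension is additive on split sequences.  This is the source of the
    invariants that separate classes in [K0]. *)
Lemma subfunctor_dim F : subfunctor F -> exists d : amod A -> nat,
  (forall X1 X2 X3, split_exact X1 X2 X3 -> d X2 = d X1 + d X3)%N /\
  forall X, exists U : 'M_(d X, mdim X), row_free U /\ forall v, F X v <-> (v <= U)%MS.
Proof.
case=> F0 FD Fc.
have /choice[d dE] : forall X, exists d : nat,
    exists U : 'M_(d, mdim X), row_free U /\ forall v, F X v <-> (v <= U)%MS.
  move=> X; have [U UE] := subspace_matrix (F0 X) (FD X).
  exists (\rank U), (row_base U); split=> [|v]; first exact: row_base_free.
  by rewrite eq_row_base.
exists d; split=> // X1 X2 X3 sX.
case/split_exactP: (sX)=> [f [g [q [s [[hf hg hq hs] [qf gs gf fq]]]]]].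
have qs := retract_section0 qf gs fq.
have [U1 [U1f U1E]] := dE X1; have [U2 [U2f U2E]] := dE X2.
have [U3 [U3f U3E]] := dE X3.
pose W := col_mx (U1 *m q) (U3 *m g).
have WU : (W :=: U2)%MS.
  apply/eqmxP/andP; split.
    rewrite col_mx_sub; apply/andP; split; apply/row_subP => i; apply/U2E; rewrite row_mul.
      by apply: Fc hq _; apply/U1E; apply: row_sub.
    by apply: Fc hg _; apply/U3E; apply: row_sub.
  apply/row_subP => i; rewrite -[row i U2]mulmx1 -fq mulmxDr !mulmxA.
  have Fi : F X2 (row i U2) by apply/U2E; apply: row_sub.
  rewrite /W -addsmxE; apply: addmx_sub_adds; apply: submxMr.
    by apply/U1E; exact: Fc hf Fi.
  by apply/U3E; exact: Fc hs Fi.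
have Wf : row_free W.
  have [V1 V1E] := row_freeP U1f; have [V3 V3E] := row_freeP U3f.
  apply/row_freeP; exists (row_mx (f *m V1) (s *m V3)).
  rewrite mul_col_row !mulmxA -!(mulmxA U1) -!(mulmxA U3) qf gs gf qs.
  by rewrite !(mul1mx, mul0mx, mulmx0) V1E V3E -scalar_mx_block.
by have := eqP Wf; rewrite WU (eqP U2f).
Qed.
End Subfunctor.

(** * Convolution *)

Section Convolution.
Variables (k : fieldType) (A : falgType k) (H : hopf A).

(** The convolution product of linear maps from the coalgebra to the algebra. *)
Definition conv (u v : A -> A) (a : A) : A := tlift (fun x y => u x * v y) (comul H a).

Lemma conv_linear u v : linear (conv u v).
Proof. by move=> c a b; rewrite /conv !linearP. Qed.

Lemma eq_conv u u' v v' : u =1 u' -> v =1 v' -> conv u v =1 conv u' v'.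
Proof. by move=> uu vv a; apply: eq_tlift => x y; rewrite uu vv. Qed.

Lemma convA (u v w : {linear A -> A}) : conv (conv u v) w =1 conv u (conv v w).
Proof.
move=> a; pose F y t := u y * tlift (fun y z => v y * w z) t.
have FS x y z : F x (tens y z) = u x * (v y * w z).
  rewrite /F tlift_tens // => b c x' y'; first by rewrite linearP mulrDr scalerAr.
  by rewrite linearP mulrDl scalerAl.
have FL x t : tlift F (tens x t) = F x t.
  apply: tlift_tens => b c x' y'; rewrite /F linearP; first by rewrite mulrDr scalerAr.
  by rewrite mulrDl scalerAl.
transitivity (tlift F (tlift (fun x y =>
    tlift (fun x1 x2 => tens x1 (tens x2 y)) (comul H x)) (comul H a))).
  rewrite (tlift_linf _ (tlift F)); apply: eq_tlift => x y.
  rewrite (tlift_linf _ (tlift F)) /conv /=.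
  pose M z := z * w y; have Ml : linear M by move=> c z z'; rewrite /M mulrDl scalerAl.
  pose ML : {linear A -> A} := HB.pack M (GRing.isLinear.Build _ _ _ _ M Ml).
  rewrite -[LHS]/(ML _) tlift_linf; apply: eq_tlift => x1 x2 /=.
  by rewrite FL FS /M mulrA.
rewrite comulA (tlift_linf _ (tlift F)); apply: eq_tlift => x y /=.
by rewrite FL.
Qed.

Definition conv_unit (a : A) : A := (counit H a : k) *: 1.

Lemma conv1r (u : {linear A -> A}) : conv u conv_unit =1 u.
Proof.
move=> a; rewrite -[in RHS](counitr H a) tlift_linf; apply: eq_tlift => x y.
by rewrite linearZ -scalerAr mulr1.
Qed.

Lemma conv1l (u : {linear A -> A}) : conv conv_unit u =1 u.
Proof.
move=> a; rewrite -[in RHS](counitl H a) tlift_linf; apply: eq_tlift => x y.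
by rewrite linearZ -scalerAl mul1r.
Qed.

Lemma conv_comp (t : {lrmorphism A -> A}) u v a :
  t (conv u v a) = conv (t \o u) (t \o v) a.
Proof. by rewrite /conv tlift_linf; apply: eq_tlift => x y; rewrite rmorphM. Qed.

Lemma conv_monoid (u v : {lrmorphism A -> A}) :
  (forall a b, u a * v b = v b * u a) -> monoid_morphism (conv u v).
Proof.
move=> uv; split=> [|a b].
  rewrite /conv comul1 tlift_tens ?rmorph1 ?mulr1 // => b c x y.
    by rewrite linearP mulrDr scalerAr.
  by rewrite linearP mulrDl scalerAl.
pose F x y := u x * v y.
rewrite /conv comulM /tmul (tlift_linf _ (tlift F)).
pose M z := z * tlift F (comul H b).
have Ml : linear M by move=> c z z'; rewrite /M mulrDl scalerAl.
pose ML : {linear A -> A} := HB.pack M (GRing.isLinear.Build _ _ _ _ M Ml).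
rewrite -[RHS]/(ML _) tlift_linf; apply: eq_tlift => x y /=.
rewrite (tlift_linf _ (tlift F)) /M /=.
pose N z := F x y * z.
have Nl : linear N by move=> c z z'; rewrite /N mulrDr scalerAr.
pose NL : {linear A -> A} := HB.pack N (GRing.isLinear.Build _ _ _ _ N Nl).
rewrite -[RHS]/(NL _) tlift_linf; apply: eq_tlift => x' y' /=.
rewrite tlift_tens /N /F => [|b' c z z'|b' c z z'].
- by rewrite !rmorphM !mulrA -(mulrA (u x)) -uv !mulrA.
- by rewrite linearP mulrDr scalerAr.
- by rewrite linearP mulrDl scalerAl.
Qed.
End Convolution.

(** * Simple modules and the twists they define *)

Section StructureGroup.
Variables (k : fieldType) (A : falgType k) (H : hopf A) (S : structure_group H).
Implicit Types X Y Z : amod A.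

Definition make_endo (f : A -> A) (fl : linear f) (fm : monoid_morphism f) :
    {lrmorphism A -> A} :=
  HB.pack f (GRing.isLinear.Build k A A _ f fl) (GRing.isMonoidMorphism.Build A A f fm).

(** A simple module has an inverse for the tensor product, and dimensions multiply. *)
Lemma simple_dim1 X : simple X -> mdim X = 1%N.
Proof.
move=> /(sclass_simple S)[g gX]; have [Y gY] := tcls_surj (sclass g^-1%g).
have : tcls H (tensor_mod H X Y) = tcls H (trivial_mod H).
  by rewrite -tclsM -gX -gY -sclassM mulgV sclass1 tcls1.
by move=> /clsP/iso_mdim/eqP; rewrite /= muln_eq1 => /andP[/eqP].
Qed.

Lemma one_dim_action X : mdim X = 1%N ->
  exists f : {lrmorphism A -> 'M[k]_1}, iso X (AMod f).
Proof. by case: X => n x /= n1; subst n; exists x; apply: iso_refl. Qed.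

(** One by one matrices commute, so conjugate actions on a line are equal. *)
Lemma iso_action1 X Y : iso X Y -> mdim X = 1%N ->
  forall a i j i' j', mact X a i j = mact Y a i' j'.
Proof.
move=> XY X1; have Y1 : mdim Y = 1%N by rewrite -(iso_mdim XY).
case: X Y XY X1 Y1 => [n x] [m y] /= XY n1 m1; subst n m.
case: XY => f [g [/= hf hg gf fg]] a i j i' j'; rewrite !ord1.
have fx : f 0 0 * x a 0 0 = y a 0 0 * f 0 0.
  by have /matrixP/(_ 0 0) := hf a; rewrite !mxE !big_ord1.
apply: (@mulfI _ (f 0 0)); last by rewrite fx mulrC.
apply/eqP => f0; have /matrixP/(_ 0 0)/eqP := fg.
by rewrite !mxE big_ord1 f0 mul0r eq_sym oner_eq0.
Qed.

Lemma simple_action_ex (g : S) :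
  exists f : {lrmorphism A -> 'M[k]_1}, sclass g = tcls H (AMod f).
Proof.
have [X gX] := tcls_surj (sclass g).
have /simple_dim1/one_dim_action[f Xf] : simple X by apply/(sclass_simple S); exists g.
by exists f; rewrite gX; apply/clsP.
Qed.

Definition simple_act (g : S) : {lrmorphism A -> 'M[k]_1} :=
  sval (cid (simple_action_ex g)).
Definition smod (g : S) : amod A := AMod (simple_act g).

Lemma sclassE g : sclass g = tcls H (smod g).
Proof. by rewrite /smod /simple_act; case: cid. Qed.

Lemma simple_smod X : simple X -> exists g, iso X (smod g).
Proof.
by case/(sclass_simple S) => g; rewrite sclassE => /esym/clsP Xg; exists g.
Qed.

Lemma smodM g h : iso (tensor_mod H (smod g) (smod h)) (smod (g * h)%g).
Proof. by apply/clsP; rewrite -[LHS]tclsM -[RHS]sclassE -!sclassE sclassM. Qed.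

Lemma smod1 : iso (smod 1%g) (trivial_mod H).
Proof. by apply/clsP; rewrite -[LHS]sclassE sclass1. Qed.

Lemma smod_inj g h : iso (smod g) (smod h) -> g = h.
Proof. by move=> gh; apply: (@sclass_inj _ _ _ S); rewrite !sclassE; apply/clsP. Qed.

Definition chi (g : S) (a : A) : k := simple_act g a 0 0.

(** The character through which [g] acts becomes an element of the convolution
    algebra once its values are read as scalars of [A]. *)
Lemma chi_algE_linear g : linear (fun a => chi g a *: (1 : A)).
Proof. by move=> c a b; rewrite /chi linearP !mxE scalerDl scalerA. Qed.
Lemma chi_algE_monoid g : monoid_morphism (fun a => chi g a *: (1 : A)).
Proof.
split=> [|a b]; first by rewrite /chi rmorph1 mxE scale1r.
by rewrite /chi rmorphM /= mxE big_ord1 -scalerAl mul1r scalerA.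
Qed.
Definition chi_alg g : {lrmorphism A -> A} :=
  make_endo (chi_algE_linear g) (chi_algE_monoid g).

Lemma chi_alg_comm g a b : chi_alg g a * b = b * chi_alg g a.
Proof. by rewrite /= -scalerAl -scalerAr mul1r mulr1. Qed.

Lemma conv_chi g h : conv H (chi_alg g) (chi_alg h) =1 chi_alg (g * h)%g.
Proof.
move=> a; pose i0 : 'I_(1 * 1) := ord0.
pose D (M : 'M[k]_(1 * 1)) : A := M i0 i0 *: 1.
have Dl : linear D by move=> c M N; rewrite /D !mxE scalerDl scalerA.
pose DL : {linear 'M[k]_(1 * 1) -> A} := HB.pack D (GRing.isLinear.Build _ _ _ _ D Dl).
rewrite /= /chi -(iso_action1 (smodM g h) (erefl 1%N) a i0 i0) -[RHS]/(DL _) tlift_linf.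
apply: eq_tlift => x y; rewrite /= /D !mxE !ord1 -scalerAl mul1r scalerA.
by [].
Qed.

Lemma chi_alg1 : chi_alg 1%g =1 conv_unit H.
Proof.
move=> a; rewrite /= /chi (iso_action1 smod1 (erefl 1%N) a 0 0 0 0) /= /trivial_act.
by rewrite mxE.
Qed.

(** The automorphisms that send [a] to the sum of chi(a') a'' and of a' chi(a''),
    where the coproduct of [a] is the sum of the a' (x) a''.  Restriction along
    them is the tensor product with [smod g] on the left and on the right. *)
Definition ltwist g : {lrmorphism A -> A} :=
  make_endo (@conv_linear _ _ H (chi_alg g) idfun)
    (conv_monoid H (fun a b => chi_alg_comm g a b : chi_alg g a * (idfun b) = _)).
Definition rtwist g : {lrmorphism A -> A} :=
  make_endo (@conv_linear _ _ H idfun (chi_alg g))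
    (conv_monoid H (fun a b => esym (chi_alg_comm g b a) : idfun a * chi_alg g b = _)).

Lemma endo_chi (t : {lrmorphism A -> A}) g : t \o chi_alg g =1 chi_alg g.
Proof. by move=> a /=; rewrite linearZ rmorph1. Qed.

(** An algebra map distributes over convolution and fixes the scalars, so both
    sides are convolution products that agree by associativity. *)
Lemma ltwistM g h a : ltwist g (ltwist h a) = ltwist (h * g)%g a.
Proof.
rewrite [ltwist h a]/(conv H (chi_alg h) idfun a) conv_comp.
rewrite (eq_conv H (endo_chi _ _) (fun=> erefl _)).
rewrite -[RHS](eq_conv H (conv_chi h g) (fun=> erefl _)).
by rewrite [RHS](convA H (chi_alg h) (chi_alg g) idfun).
Qed.
Lemma rtwistM g h a : rtwist g (rtwist h a) = rtwist (g * h)%g a.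
Proof.
rewrite [rtwist h a]/(conv H idfun (chi_alg h) a) conv_comp.
rewrite (eq_conv H (fun=> erefl _) (endo_chi _ _)).
rewrite -[RHS](eq_conv H (fun=> erefl _) (conv_chi g h)).
by rewrite -[RHS](convA H idfun (chi_alg g) (chi_alg h)).
Qed.

Lemma ltwist1 a : ltwist 1%g a = a.
Proof.
rewrite -[LHS]/(conv H (chi_alg 1%g) idfun a) (eq_conv H chi_alg1 (fun=> erefl _)).
exact: (conv1l H idfun).
Qed.

Lemma rtwist1 a : rtwist 1%g a = a.
Proof.
rewrite -[LHS]/(conv H idfun (chi_alg 1%g) a) (eq_conv H (fun=> erefl _) chi_alg1).
exact: (conv1r H idfun).
Qed.

Lemma ltwistK g : cancel (ltwist g) (ltwist g^-1%g).
Proof. by move=> a; rewrite ltwistM mulgV ltwist1. Qed.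
Lemma ltwistVK g : cancel (ltwist g^-1%g) (ltwist g).
Proof. by move=> a; rewrite ltwistM mulVg ltwist1. Qed.
Lemma rtwistK g : cancel (rtwist g) (rtwist g^-1%g).
Proof. by move=> a; rewrite rtwistM mulVg rtwist1. Qed.
Lemma rtwistVK g : cancel (rtwist g^-1%g) (rtwist g).
Proof. by move=> a; rewrite rtwistM mulgV rtwist1. Qed.

Lemma tensor_smodl g X : iso (tensor_mod H (smod g) X) (restriction (ltwist g) X).
Proof.
apply: (@iso_cast _ _ (tensor_mod H (smod g) X) (restriction (ltwist g) X) (mul1n _)) => a.
rewrite -[RHS]/(mact X (conv H (chi_alg g) idfun a)) /conv (tlift_linf _ (mact X)) /=.
pose G := fun M : 'M[k]_(1 * mdim X) => castmx (mul1n (mdim X), mul1n (mdim X)) M.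
have Glin : linear G by exact: castmx_linear.
pose GL : {linear _ -> _} := HB.pack G (GRing.isLinear.Build _ _ _ _ G Glin).
rewrite /tensor_act -[LHS]/(GL _) tlift_linf; apply: eq_tlift => x y /=.
rewrite -scalerAl mul1r linearZ /G /=; apply/matrixP => i j; rewrite castmxE !mxE /=.
rewrite /chi !ord1; congr (_ * mact X y _ _).
  by apply/val_inj; rewrite /= modn_small.
by apply/val_inj; rewrite /= modn_small.
Qed.

Lemma tensor_smodr g X : iso (tensor_mod H X (smod g)) (restriction (rtwist g) X).
Proof.
apply: (@iso_cast _ _ (tensor_mod H X (smod g)) (restriction (rtwist g) X) (muln1 _)) => a.
rewrite -[RHS]/(mact X (conv H idfun (chi_alg g) a)) /conv (tlift_linf _ (mact X)) /=.
pose G := fun M : 'M[k]_(mdim X * 1) => castmx (muln1 (mdim X), muln1 (mdim X)) M.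
have Glin : linear G by exact: castmx_linear.
pose GL : {linear _ -> _} := HB.pack G (GRing.isLinear.Build _ _ _ _ G Glin).
rewrite /tensor_act -[LHS]/(GL _) tlift_linf; apply: eq_tlift => x y /=.
rewrite -scalerAr mulr1 linearZ /G /=; apply/matrixP => i j; rewrite castmxE !mxE /=.
rewrite /chi !ord1 mulrC; congr (_ * mact X x _ _).
  by apply/val_inj; rewrite /= divn1.
by apply/val_inj; rewrite /= divn1.
Qed.
End StructureGroup.

(** * Classes of semisimple and projective modules *)

Section K0.
Variables (k : fieldType) (A : falgType k) (H : hopf A) (S : structure_group H).
Implicit Types X Y Z K Q : amod A.
Local Notation cl := (K0_class H).
Local Notation e := (fun g : S => cl (smod g)).

Lemma K0_class_iso X Y : iso X Y -> cl X = cl Y.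
Proof. by move=> /clsP XY; rewrite /K0_class /tcls XY. Qed.

Lemma K0_class0 X : mdim X = 0%N -> cl X = 0.
Proof.
move=> X0; apply: (addIr (cl X)); rewrite add0r.
exact/esym/K0_class_split/split_exact0.
Qed.

Lemma classM X Y : cl X * cl Y = cl (tensor_mod H X Y).
Proof. exact: K0_classM. Qed.

Lemma class_smodM g h : e (g * h)%g = e g * e h.
Proof. by rewrite classM; apply/esym/K0_class_iso/smodM. Qed.

Lemma class_smod1 : e 1%g = 1.
Proof. by rewrite -K0_class1; apply/K0_class_iso/smod1. Qed.

Lemma class_semisimple X : semisimple X -> exists u : {ffun S -> int}, cl X = zcomb e u.
Proof.
elim=> [{}X X0|S' Y {}X sS' _ [u uE] sX].
  by exists 0; rewrite zcomb0 K0_class0.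
have [g S'g] := simple_smod S sS'.
exists ([ffun x => (x == g)%:R] + u).
by rewrite (K0_class_split H sX) zcombD zcomb_delta uE (K0_class_iso S'g).
Qed.

Variable P1 : amod A.
Hypothesis P1_cover : projective_cover P1 (trivial_mod H).
Local Notation p := (cl P1).

Definition pmod (g : S) : amod A := restriction (ltwist g) P1.

Lemma pmod_cover g : projective_cover (pmod g) (smod g).
Proof.
have := restriction_cover (ltwistK g) (ltwistVK g) P1_cover.
apply: cover_iso; apply: iso_trans (iso_sym (tensor_smodl g _)) _.
exact: tensor_mod1r.
Qed.

Lemma class_pmod g : e g * p = cl (pmod g).
Proof. by rewrite classM; apply/K0_class_iso/tensor_smodl. Qed.

(** The twist P_1 (x) g is projective and maps onto [g], so the cover [pmod g] is a
    summand of it; the dimensions are equal, so the complement is zero. *)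
Lemma class_P1_comm g : p * e g = e g * p.
Proof.
rewrite class_pmod classM (K0_class_iso (tensor_smodr g P1)).
have [prQ [q [hq eq _]]] : projective_cover (restriction (rtwist g) P1) (smod g).
  have := restriction_cover (rtwistK g) (rtwistVK g) P1_cover.
  apply: cover_iso; apply: iso_trans (iso_sym (tensor_smodr g _)) _.
  exact: tensor_mod1l.
have [K sK _] := cover_summand (pmod_cover g) prQ hq eq.
rewrite (K0_class_split H sK) K0_class0 ?add0r //.
have /eqP := split_exact_mdim sK; rewrite /= -{1}[mdim P1]add0n eqn_add2r.
by rewrite eq_sym => /eqP.
Qed.

Lemma pmod_dim_gt0 g : (0 < mdim (pmod g))%N.
Proof. by have [_ [q [_ eq _]]] := pmod_cover g; apply: leq_trans (epi_dim eq). Qed.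

(** The cover of a simple quotient splits off, which lowers the dimension. *)
Lemma class_projective X : projective X -> exists v : {ffun S -> int}, cl X = zcomb e v * p.
Proof.
move: {2}(mdim X) (leqnn (mdim X)) => n; elim: n X => [|n IH] X.
  by rewrite leqn0 => /eqP X0 _; exists 0; rewrite zcomb0 mul0r K0_class0.
move=> Xn prX; have [X0|X0] := eqVneq (mdim X) 0%N.
  by exists 0; rewrite zcomb0 mul0r K0_class0.
have [Z [w [sZ hw ew]]] := simple_quotient (elimN eqP X0).
have [g [f [f' [hf hf' ff' f'f]]]] := simple_smod S sZ.
have ef : epi (f *m w).
  have [s ws] := (epiP _).1 ew; apply/epiP; exists (s *m f').
  by rewrite -mulmxA (mulmxA w) ws mul1mx.
have [K sK prK] := cover_summand (pmod_cover g) prX (hom_comp hw hf) ef.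
have [v vE] : exists v : {ffun S -> int}, cl K = zcomb e v * p.
  apply: IH prK; rewrite -ltnS; apply: leq_trans Xn.
  by rewrite (split_exact_mdim sK) -addn1 leq_add2l pmod_dim_gt0.
exists (v + [ffun x => (x == g)%:R]).
by rewrite (K0_class_split H sK) zcombD zcomb_delta mulrDl class_pmod vE.
Qed.

Lemma tensor_exact Y X1 X2 X3 : short_exact X1 X2 X3 ->
  short_exact (tensor_mod H X1 Y) (tensor_mod H X2 Y) (tensor_mod H X3 Y).
Proof.
move=> [f [g ex]]; have [q [s [qf gs gf fq]]] := linear_splitting ex.
case: ex => hf hg _ _ _.
have h1 : is_hom Y Y 1%:M by move=> a; rewrite mul1mx mulmx1.
exists (f *t 1%:M), (g *t 1%:M); split; try exact: tensor_hom.
- by apply/monoP; exists (q *t 1%:M); rewrite tensmx_mul qf mul1mx tens1mx.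
- by apply/epiP; exists (s *t 1%:M); rewrite tensmx_mul gs mul1mx tens1mx.
have fq1 : (f *t 1%:M) *m (q *t 1%:M) + (s *t 1%:M) *m (g *t 1%:M) = 1%:M
    :> 'M_(mdim X2 * mdim Y).
  rewrite !tensmx_mul mul1mx -tens1mx -fq.
  by have := tensmx_linl (1%:M : 'M_(mdim Y)) 1 (f *m q) (s *m g); rewrite !scale1r.
move=> v; split=> [gv|[u <-]]; last by rewrite mulmxA tensmx_mul gf tens0mx mul0mx.
exists ((q *t 1%:M) *m v); rewrite -[RHS]mul1mx -fq1 mulmxDl -[X in _ = _ + X]mulmxA gv.
by rewrite mulmx0 addr0 mulmxA.
Qed.

(** The sequence 0 -> X' (x) P_1 -> X (x) P_1 -> S' (x) P_1 -> 0 splits because its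
    last term is projective. *)
Lemma comp_factors_tensor_P1 X l : comp_factors X l ->
  cl X * p = zcomb e [ffun g => (count_mem (sclass g) l)%:Z] * p.
Proof.
elim=> [{}X X0|{}X X' S' {}l ex sS' _ IH].
  by rewrite K0_class0 // -[X in X * _ = _](zcomb0 e).
have [g S'g] := simple_smod S sS'.
have prS' : projective (tensor_mod H S' P1).
  apply: (@projective_iso _ _ (pmod g)); last by case: (pmod_cover g).
  apply: iso_trans (iso_sym (tensor_smodl g P1)) _; apply: tensor_iso (iso_sym S'g) _.
  exact: iso_refl.
have [f [f' exf]] := tensor_exact P1 ex.
rewrite classM (K0_class_split H (exact_projective_split exf prS')) -!classM IH -mulrDl.
rewrite addrC (K0_class_iso S'g) -(zcomb_delta e) -zcombD; congr (zcomb _ _ * _).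
apply/ffunP => h; rewrite !ffunE /= PoszD; congr (_ + _).
have -> : cls S' = sclass g by rewrite sclassE; apply/clsP.
by rewrite (inj_eq (@sclass_inj _ _ _ S)) eq_sym; case: (g == h).
Qed.
End K0.

(** * Linear independence of the classes *)

Section Independence.
Variables (k : fieldType) (A : falgType k) (H : hopf A) (S : structure_group H).
Implicit Types X Y Z K Q : amod A.
Local Notation cl := (K0_class H).
Local Notation e := (fun g : S => cl (smod g)).
Variable P1 : amod A.
Hypothesis P1_cover : projective_cover P1 (trivial_mod H).
Local Notation p := (cl P1).

(** A simple quotient splits off when it is projective. *)
Lemma semisimple_of_projective_simples : (forall g : S, projective (smod g)) ->
  forall X, semisimple X.
Proof.
move=> prS X; move: {2}(mdim X) (leqnn (mdim X)) => n; elim: n X => [|n IH] X.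
  by rewrite leqn0 => /eqP; apply: semisimple0.
move=> Xn; have [X0|X0] := eqVneq (mdim X) 0%N; first exact: semisimple0.
have [Z [w [sZ hw ew]]] := simple_quotient (elimN eqP X0).
have [g Zg] := simple_smod S sZ; have Z1 := simple_dim1 S sZ.
have [K [j ex]] := kernel_exact hw ew.
have sX := exact_projective_split ex (projective_iso (iso_sym Zg) (prS g)).
apply: semisimpleS sZ _ (split_exact_sym sX); apply: IH; rewrite -ltnS.
by apply: leq_trans Xn; rewrite (split_exact_mdim sX) Z1 addn1.
Qed.

(** If [P1] were a line, each cover [pmod g] would be isomorphic to [smod g], so the
    simple modules would be projective. *)
Lemma P1_dim_gt1 : ~ semisimple_algebra A -> (1 < mdim P1)%N.
Proof.
move=> nss; rewrite ltnNge; apply/negP => dim1; apply: nss.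
apply: semisimple_of_projective_simples => g.
have [pr [q [hq eq _]]] := pmod_cover P1_cover g.
have P11 : mdim (pmod P1 g) = 1%N.
  by apply/eqP; rewrite eqn_leq dim1 (pmod_dim_gt0 P1_cover g).
have [s qs] := (epiP q).1 eq.
have sq : s *m q = 1%:M.
  move: q s qs {hq eq}; rewrite /= in P11 *; rewrite P11 => q s qs.
  by rewrite [s]mx11_scalar [q]mx11_scalar scalar_mxC -!mx11_scalar.
apply: projective_iso pr; exists q, s; split=> // a.
by rewrite -[mact _ a in LHS]mulmx1 -qs (mulmxA _ q) -hq -mulmxA (mulmxA s) sq mul1mx.
Qed.

Lemma K0_functional (d : amod A -> nat) :
  (forall X1 X2 X3, split_exact X1 X2 X3 -> d X2 = d X1 + d X3)%N ->
  exists F : {additive K0 H -> int}, forall X, F (cl X) = (d X)%:Z.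
Proof.
move=> dE; have d0 : forall X, mdim X = 0%N -> d X = 0%N.
  move=> X X0; apply: (@addnI (d X)); rewrite addn0; exact/esym/dE/split_exact0.
have d_iso X Y : iso X Y -> d X = d Y.
  move=> [f [g [hf hg gf fg]]].
  have ef : epi f by apply/epiP; exists g.
  have [K [j ex]] := kernel_exact hf ef.
  have sK : split_exact K X Y by exists j, f; split=> //; exists g.
  rewrite (dE _ _ _ sK) d0 //; have /eqP := split_exact_mdim sK.
  rewrite -(iso_mdim (_ : iso X Y)) -1?{1}[mdim X]add0n ?eqn_add2r; last by exists f, g.
  by rewrite eq_sym => /eqP.
pose f (x : tensor_class H) : int := (d (generic_quotient.repr x))%:Z.
have [|F Ff] := @presented_lift _ (Relations (@split_relation_mull _ _ H)
    (@split_relation_mulr _ _ H)) int (f : _ -> zmodule int).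
  move=> _ [X1 X2 X3 sX]; rewrite linearB linearD /= !fext_gen /f.
  have -> : d (generic_quotient.repr (tcls H X2)) = d X2 by apply: d_iso; apply: reprP.
  have -> : d (generic_quotient.repr (tcls H X1)) = d X1 by apply: d_iso; apply: reprP.
  have -> : d (generic_quotient.repr (tcls H X3)) = d X3 by apply: d_iso; apply: reprP.
  by rewrite (dE _ _ _ sX) PoszD subrr.
by exists F => X; rewrite [LHS]Ff /f; congr Posz; apply: d_iso; apply: reprP.
Qed.

Lemma dim_eq0 d n (U : 'M[k]_(d, n)) :
  row_free U -> (forall v : 'rV_n, (v <= U)%MS -> v = 0) -> d = 0%N.
Proof.
move=> Uf U0; rewrite -(eqP Uf); apply/eqP; rewrite mxrank_eq0; apply/eqP/row_matrixP => i.
by rewrite row0; apply: U0; apply: row_sub.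
Qed.

Lemma dim_eq1 d n (U : 'M[k]_(d, n)) (q : 'rV_n) : row_free U -> q != 0 ->
  (forall v : 'rV_n, (v <= U)%MS <-> exists c, v = c *: q) -> d = 1%N.
Proof.
move=> Uf q0 UE; have qU : (q <= U)%MS by apply/UE; exists 1; rewrite scale1r.
have Uq : (U <= q)%MS.
  apply/row_subP => i; have /UE[c ->] := row_sub i U.
  by rewrite scalemx_sub.
have UqE : (U :=: q)%MS by apply/eqmxP; rewrite Uq qU.
by rewrite -(eqP Uf) UqE rank_rV q0.
Qed.

(** Let [K] be the kernel of [w].  If [q] does not vanish on [K], then [K] covers the
    line, hence is all of [P] and [w] is zero.  Otherwise [w] and [q] have the same
    kernel and are proportional. *)
Lemma cover_hom_line (P : amod A) (f : {lrmorphism A -> 'M[k]_1}) (q w : 'rV[k]_(mdim P)) :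
  q != 0 -> (forall Y (h : 'M_(mdim P, mdim Y)), is_hom Y P h -> epi (q *m h) -> epi h) ->
  is_hom P (AMod f) w -> exists c, w = c *: q.
Proof.
move=> q0 essq hw; have [->|w0] := eqVneq w 0; first by exists 0; rewrite scale0r.
have [K [j [hj mj jE]]] := kernel_module hw.
have wj : w *m j = 0.
  apply/matrixP => i l; have : w *m (j *m delta_mx l 0) = 0 :> 'cV_1.
    by apply/(jE _).2; exists (delta_mx l 0).
  by rewrite mulmxA -colE => /matrixP/(_ i 0); rewrite !mxE.
have [qj|qj] := eqVneq (q *m j) 0; last first.
  have /epiP[s js] : epi j by apply: essq hj (epi_row qj).
  by exists 0; rewrite scale0r -[w]mulmx1 -js mulmxA wj mul0mx.
have /epiP[v wv] := epi_row w0.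
have qE : q = (q *m v) *m w.
  apply/eqP; rewrite -subr_eq0 -mulmxA -{1}[q]mulmx1 -mulmxBr; apply/eqP/matrixP => i l.
  have /jE[u uE] : w *m col l (1%:M - v *m w) = 0.
    by rewrite colE mulmxA mulmxBr mulmxA wv mulmx1 mul1mx subrr mul0mx.
  have : q *m col l (1%:M - v *m w) = 0 by rewrite -uE mulmxA qj mul0mx.
  by rewrite colE mulmxA -colE => /matrixP/(_ i 0); rewrite !mxE.
rewrite [q *m v]mx11_scalar mul_scalar_mx in qE; set c := (q *m v) 0 0 in qE.
have c0 : c != 0 by apply: contraNneq q0 => c0; rewrite qE c0 scale0r.
by exists c^-1; rewrite qE scalerA mulVf // scale1r.
Qed.

(** [N] is the dimension of Hom(X, g), and [T] that of its subspace of maps that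
    factor through the cover of [g].  The two agree on projectives.  A map from a
    simple module that factors and is nonzero would make the cover a line, by
    essentiality. *)
Lemma class_functionals (g : S) : (1 < mdim P1)%N ->
  exists N T : {additive K0 H -> int}, forall h,
    [/\ N (e h) = (h == g)%:R, N (e h * p) = (h == g)%:R,
        T (e h) = 0 & T (e h * p) = (h == g)%:R].
Proof.
move=> P1_gt1.
pose F1 X (w : 'rV[k]_(mdim X)) := is_hom X (smod g) w.
have [prg [q [hq eq essq]]] := pmod_cover P1_cover g.
pose F2 X (w : 'rV[k]_(mdim X)) := exists f, is_hom X (pmod P1 g) f /\ w = q *m f.
have homD X Y (f f' : 'M_(mdim Y, mdim X)) c :
    is_hom X Y f -> is_hom X Y f' -> is_hom X Y (c *: f + f').
  by move=> hf hf' a; rewrite mulmxDl mulmxDr -scalemxAl -scalemxAr hf hf'.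
have hom0 X Y : is_hom X Y 0 by move=> a; rewrite mul0mx mulmx0.
have sF1 : subfunctor F1.
  split=> [X|X c v w|X Y f v hf hv]; [exact: hom0 | exact: homD | exact: hom_comp hf hv].
have sF2 : subfunctor F2.
  split=> [X|X c v w [f [hf ->]] [f' [hf' ->]]|X Y f v hf [f' [hf' ->]]].
  - by exists 0; split; [exact: hom0 | rewrite mulmx0].
  - by exists (c *: f + f'); split; [exact: homD | rewrite mulmxDr scalemxAr].
  - by exists (f' *m f); split; [exact: hom_comp hf hf' | rewrite mulmxA].
have [d1 [d1D d1E]] := subfunctor_dim sF1; have [d2 [d2D d2E]] := subfunctor_dim sF2.
have [N NE] := K0_functional d1D; have [T TE] := K0_functional d2D.
exists N, T => h; rewrite (class_pmod _ h) !NE !TE.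
have F21 X w : F2 X w -> F1 X w by move=> [f [hf ->]]; apply: hom_comp hf hq.
have one_hom (c : k) (X : amod A) : is_hom X X c%:M by move=> a; rewrite scalar_mxC.
have homs_smod (w : 'rV[k]_(mdim (smod h))) : F1 (smod h) w -> w != 0 -> h = g.
  move=> hw w0; apply: smod_inj; have /epiP[s ws] := epi_row w0.
  have sw : s *m w = 1%:M.
    rewrite [s](mx11_scalar (s : 'M_1)) [w](mx11_scalar (w : 'M_1)) scalar_mxC.
    by rewrite -!mx11_scalar.
  exists w, s; split=> // a.
  by rewrite -[mact _ a in LHS]mulmx1 -ws (mulmxA _ w) -hw -mulmxA (mulmxA s) sw mul1mx.
have pmod_homs (w : 'rV[k]_(mdim (pmod P1 h))) : F1 (pmod P1 h) w -> w != 0 -> h = g.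
  move=> hw w0; have [prh [q' [hq' eq' essq']]] := pmod_cover P1_cover h.
  have q'0 := @epi_neq0 _ _ _ q' eq'.
  have [c wE] := cover_hom_line q'0 essq' hw.
  have c0 : c != 0 by apply: contraNneq w0 => c0; rewrite wE c0 scale0r.
  have hq'g : is_hom (pmod P1 h) (smod g) q'.
    by move=> a; have := hw a; rewrite wE -scalemxAl -scalemxAr => /(scalerI c0).
  have /epiP[s qs] := eq'.
  apply: smod_inj; exists 1%:M, 1%:M; split=> [a|a||]; rewrite ?mul1mx ?mulmx1 //.
    by rewrite -[LHS]mulmx1 -qs mulmxA -hq' hq'g -mulmxA qs mulmx1.
  by rewrite -[LHS]mulmx1 -qs mulmxA -hq'g hq' -mulmxA qs mulmx1.
have zero1 X : (forall w, F1 X w -> w = 0) -> d1 X = 0%N.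
  by have [U [Uf UE]] := d1E X => h0; apply: dim_eq0 Uf _ => v /UE/h0.
have zero2 X : (forall w, F2 X w -> w = 0) -> d2 X = 0%N.
  by have [U [Uf UE]] := d2E X => h0; apply: dim_eq0 Uf _ => v /UE/h0.
have d2s : d2 (smod h) = 0%N.
  apply: zero2 => w [f [hf wE]]; apply/eqP/negPn/negP => w0.
  have /epi_dim /= : epi f by apply: essq hf _; rewrite -wE; apply: epi_row.
  by rewrite leqNgt P1_gt1.
have [hg|hg] := eqVneq h g; last first.
  have null n (F : 'rV[k]_n -> Prop) :
      (forall w, F w -> w != 0 -> h = g) -> forall w, F w -> w = 0.
    move=> Fhg w hw; apply/eqP/negPn/negP => w0.
    by have /eqP := Fhg w hw w0; rewrite (negPf hg).
  rewrite d2s !zero1 ?zero2 //; [|exact: null pmod_homs|exact: null homs_smod].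
  by apply: null => w /F21; apply: pmod_homs.
subst h; have q0 := @epi_neq0 _ _ _ q eq.
have -> : d1 (smod g) = 1%N.
  have [U [Uf UE]] := d1E (smod g).
  apply: (@dim_eq1 _ _ U (1%:M : 'M_1) Uf _).
    by apply/eqP => /matrixP/(_ 0 0)/eqP; rewrite !mxE oner_eq0.
  move=> v; rewrite -UE; split=> [_|_].
    by exists (v 0 0); rewrite [LHS](mx11_scalar (v : 'M_1)) scalemx1.
  by rewrite /F1 [v](mx11_scalar (v : 'M_1)); apply: (one_hom _ (smod g)).
have q_hom c : is_hom (pmod P1 g) (smod g) (c *: q).
  by move=> a; rewrite -scalemxAl hq scalemxAr.
have -> : d1 (pmod P1 g) = 1%N.
  have [U [Uf UE]] := d1E (pmod P1 g); apply: (dim_eq1 Uf q0) => v; rewrite -UE.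
  by split=> [hv|[c ->]]; [exact: cover_hom_line q0 essq hv | exact: q_hom].
have -> : d2 (pmod P1 g) = 1%N.
  have [U [Uf UE]] := d2E (pmod P1 g); apply: (dim_eq1 Uf q0) => v; rewrite -UE.
  split=> [/F21 hv|[c ->]]; first exact: cover_hom_line q0 essq hv.
  by exists c%:M; split; [exact: one_hom | rewrite mul_mx_scalar].
by rewrite d2s.
Qed.

(** [T] kills the simple classes and so detects [v]; then [N] detects [u]. *)
Lemma class_free (u v : {ffun S -> int}) : (1 < mdim P1)%N ->
  zcomb e u + zcomb e v * p = 0 -> u = 0 /\ v = 0.
Proof.
move=> P1_gt1 uv0.
have FE (F : {additive K0 H -> int}) :
    \sum_h u h * F (e h) + \sum_h v h * F (e h * p) = 0.
  transitivity (F (zcomb e u + zcomb e v * p)); last by rewrite uv0 raddf0.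
  rewrite raddfD /zcomb mulr_suml !raddf_sum; congr (_ + _).
    by apply: eq_bigr => h _; rewrite raddfMz -mulrzl intz.
  by apply: eq_bigr => h _; rewrite mulrzAl raddfMz -mulrzl intz.
have pick (w : {ffun S -> int}) g : \sum_h w h * (h == g)%:R = w g.
  rewrite (bigD1 g) //= eqxx mulr1 big1 ?addr0 // => h hg.
  by rewrite (negPf hg) mulr0.
have v0 : v = 0.
  apply/ffunP => g; rewrite ffunE; have [N [T NT]] := class_functionals g P1_gt1.
  have := FE T; rewrite big1 ?add0r => [vg|h _]; last first.
    by have [_ _ -> _] := NT h; rewrite mulr0.
  rewrite -(pick v g); transitivity (\sum_h v h * T (e h * p)); last exact: vg.
  by apply: eq_bigr => h _; have [_ _ _ ->] := NT h.
split=> //; apply/ffunP => g; rewrite ffunE.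
have [N [T NT]] := class_functionals g P1_gt1.
have := FE N; rewrite addrC big1 ?add0r => [ug|h _]; last by rewrite v0 ffunE mul0r.
rewrite -(pick u g); transitivity (\sum_h u h * N (e h)); last exact: ug.
by apply: eq_bigr => h _; have [-> _ _ _] := NT h.
Qed.
End Independence.

(** * The projective class ring *)

Section ProjectiveClassRing.
Variables (k : fieldType) (A : falgType k) (H : hopf A) (S : structure_group H).
Local Notation cl := (K0_class H).
Local Notation e := (fun g : S => cl (smod g)).

Lemma in_K0p_class X : projective X \/ semisimple X -> in_K0p (cl X).
Proof. by move=> hX; apply/asboolP => G _; apply. Qed.

Lemma simple_semisimple (X : amod A) : simple X -> semisimple X.
Proof.
move=> sX; have id_hom : is_hom X X 1%:M by move=> a; rewrite mul1mx mulmx1.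
have [K [j ex]] := kernel_exact id_hom ((epiP _).2 (ex_intro _ 1%:M (mul1mx 1%:M))).
have sK : split_exact K X X by exists j, 1%:M; split=> //; exists 1%:M; rewrite mul1mx.
apply: semisimpleS sX _ (split_exact_sym sK); apply: semisimple0.
have /eqP := split_exact_mdim sK; rewrite -{1}[mdim X]add0n eqn_add2r.
by rewrite eq_sym => /eqP.
Qed.

(** K_0^p is the quotient of the polynomial ring ZS[x] by x^2 - c x, with x the class
    of the projective cover of the trivial module. *)
Lemma K0p_presentation (c : {ffun S -> int}) :
  ~ semisimple_algebra A -> canonical_element c ->
  exists (e' : S -> K0p H) (p' : K0p H),
    [/\ e' 1%g = 1 /\ (forall g h, e' (g * h)%g = e' g * e' h),
        forall g, p' * e' g = e' g * p',
        p' * p' = zcomb e' c * p',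
        forall t, exists u v, t = zcomb e' u + zcomb e' v * p' &
        forall u v, zcomb e' u + zcomb e' v * p' = 0 -> u = 0 /\ v = 0].
Proof.
move=> nss [P1 P1_cover [l P1l cl_l]].
have e_in g : in_K0p (e g).
  by apply: in_K0p_class; right; apply: simple_semisimple; apply: simple_mdim1.
have p_in : in_K0p (cl P1) by apply: in_K0p_class; left; case: P1_cover.
pose e' g : K0p H := MkK0p (e_in g); pose p' : K0p H := MkK0p p_in.
have val_zcomb u : val (zcomb e' u) = zcomb e u.
  by rewrite rmorph_sum; apply: eq_bigr => g _; rewrite rmorphMz.
have p_sq : cl P1 * cl P1 = zcomb e c * cl P1.
  rewrite (comp_factors_tensor_P1 S P1_cover P1l); congr (zcomb _ _ * _).
  by apply/ffunP => g; rewrite ffunE cl_l.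
have p_comm g : cl P1 * e g = e g * cl P1 by exact: class_P1_comm.
exists e', p'; split.
- by split=> [|g h]; apply: val_inj; [exact: class_smod1 | exact: class_smodM].
- by move=> g; apply: val_inj; exact: p_comm.
- by apply: val_inj; rewrite !rmorphM /= val_zcomb.
- move=> t; have /asboolP t_in := valP t.
  have [X [prX|ssX]|u [v tE]] := asboolP _ (t_in _ (span_subring (class_smod1 S)
    (@class_smodM _ _ _ S) p_comm p_sq) _).
  + have [v ->] := class_projective S P1_cover prX.
    by apply/asboolP; exists 0, v; rewrite zcomb0 add0r.
  + have [u ->] := class_semisimple S ssX.
    by apply/asboolP; exists u, 0; rewrite zcomb0 mul0r addr0.
  by exists u, v; apply: val_inj; rewrite rmorphD rmorphM /= !val_zcomb; exact: tE.
- move=> u v uv0; apply: (class_free P1_cover (P1_dim_gt1 S P1_cover nss)).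
  by rewrite -!val_zcomb -[cl P1]/(val p') -rmorphM -rmorphD uv0 rmorph0.
Qed.
End ProjectiveClassRing.

Local Open Scope classical_set_scope.
Local Open Scope card_scope.

Theorem theorem3p12 (R : realType) (k : fieldType) (A : falgType k) (H : hopf A)
    (S : structure_group H) (s r : nat) (c : {ffun S -> int})
    (A_basic : basic_algebra A) (A_split : split_algebra A)
    (A_not_semisimple : ~ semisimple_algebra A)
    (S_abelian : abelian [set: S]%G) (S_order : #|S| = s)
    (c_canonical : canonical_element c)
    (r_count : [set chi : {ffun S -> R[i]} |
                  irreducible_character chi /\ char_eval chi c <> 0] #= `I_r) :
  exists phi : base_change R[i] (K0p H) ->
      ({ffun 'I_(2 * r) -> R[i]^o} *
       {ffun 'I_(s - r) -> {poly %/ ('X^2 : {poly R[i]})}})%type,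
    [/\ bijective phi, linear phi & monoid_morphism phi].
Proof.
have [e [p [[e1 eM] pC pp span free]]] := K0p_presentation A_not_semisimple c_canonical.
have [X [X_inj X_char X_surj X_free]] := linear_characters_basis R[i] S_abelian.
have X_lin i : is_linear_character (X i) by apply/X_char; exists i.
apply: (base_change_split e1 eM pC pp span free _ _ X_surj X_free S_order).
- by move=> i; case: (X_lin i).
- by move=> i; case: (X_lin i).
have [f f_bij] := @enum_bij {i : S | char_eval (X i) c != 0} _ (card_sig _).
apply/card_eq_II; apply: card_eq_trans r_count; rewrite card_eq_sym.
have -> : [set chi : {ffun S -> R[i]} | irreducible_character chi /\ char_eval chi c <> 0] =
    (fun j => X (val (f j))) @` [set: 'I__].
  apply/seteqP; split=> [chi [chi_irr /eqP]|_ [j _ <-]].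
    have /X_char[i ->] := (irreducible_characterP S_abelian chi).1 chi_irr => Xi.
    by have [f' _ f'K] := f_bij; exists (f' (Sub i Xi)); rewrite ?f'K.
  split; last exact/eqP/(valP (f j)).
  exact/(irreducible_characterP S_abelian)/X_lin.
apply: card_eq_trans (inj_card_eq _) _; last by rewrite card_eq_sym card_II.
by move=> i j _ _ /X_inj/val_inj/(bij_inj f_bij).
Qed.
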